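(* Let $\mathbb{O}=(W,(\cdot|\cdot),\wedge)$ be the real Cayley–Dickson octonion division algebra. The real noncommutative Jordan linear division algebras of dimension $8$ are obtained from $\mathbb{O}$ by vectorial isotopy, and they are, up to isomorphism, exactly the algebras $\mathbb{O}(s)$, where $s$ is a positive definite symmetric automorphism of the Euclidean space $(W,-(\cdot|\cdot))$. Moreover, if $s$ and $s'$ are two positive definite symmetric automorphisms of $(W,-(\cdot|\cdot))$, then $\mathbb{O}(s')\simeq\mathbb{O}(s)$ if and only if there exists $f\in G_2$ such that $\widetilde{s'}=f^{-1}\,\widetilde{s}\,f$.
   Context: Algebras are vector spaces with a bilinear product, not assumed associative. $(x,y,z)=(xy)z-x(yz)$. An algebra is noncommutative Jordan if $(x,y,x)=0$ and $(x^2,y,x)=0$ for all $x,y$. An algebra $A\neq\{0\}$ is a linear division algebra if for every nonzero $x$ the maps $y\mapsto xy$ and $y\mapsto yx$ are bijective. For an anticommutative bilinear product $\ast$ and a symmetric bilinear form $(\cdot|\cdot)$ on a real vector space $W$, $(W,(\cdot|\cdot),\ast)$ denotes the real algebra $\mathbb{R}1\oplus W$ with product $(\alpha+x)(\beta+y)=(\alpha\beta+(x|y))+(\alpha y+\beta x+x\ast y)$. The octonion division algebra $\mathbb{O}$ is of this form with $W$ the 7-dimensional space of purely imaginary octonions, $(x|y)$ the scalar part and $x\wedge y$ the imaginary part of $xy$; here $(\cdot|\cdot)$ is negative definite. For a linear automorphism $\varphi$ of $W$, with adjoint $\varphi^*$ for $(\cdot|\cdot)$, $\mathbb{O}(\varphi)=(W,(\cdot|\cdot),\Delta)$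 with $x\Delta y=\varphi^*(\varphi(x)\wedge\varphi(y))$; $\mathbb{O}(\varphi)$ is said to be obtained from $\mathbb{O}$ (and $\varphi$) by vectorial isotopy. For a linear automorphism $s$ of $W$, $\widetilde s$ is its extension $\alpha+u\mapsto\alpha+s(u)$ to $\mathbb{R}1\oplus W$. $G_2$ is the automorphism group of the algebra $\mathbb{O}$. *)

(* Defs.v *)
From HB Require Import structures.
From mathcomp Require Import all_boot all_order all_algebra.
From mathcomp Require Import boolp classical_sets reals.
From mathcomp Require Import ring lra.
Set Implicit Arguments.
Unset Strict Implicit.
Unset Printing Implicit Defensive.
Import Order.TTheory GRing.Theory Num.Theory.
Local Open Scope ring_scope.

(* A real algebra is a finite-dimensional real vector space [A : vectType R]
   together with a product [mul : {bilinear A -> A -> A}]. *)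
Section Algebras.
Variable R : realType.

Definition associator (A : vectType R) (mul : {bilinear A -> A -> A})
    (x y z : A) : A :=
  mul (mul x y) z - mul x (mul y z).

Definition noncommutative_Jordan (A : vectType R)
    (mul : {bilinear A -> A -> A}) : Prop :=
  forall x y : A,
    associator mul x y x = 0 /\ associator mul (mul x x) y x = 0.

Definition linear_division (A : vectType R)
    (mul : {bilinear A -> A -> A}) : Prop :=
  (exists x : A, x != 0) /\
  (forall x : A, x != 0 -> bijective (fun y => mul x y) /\
                           bijective (fun y => mul y x)).

Definition alg_iso (A B : vectType R) (mulA : {bilinear A -> A -> A})
    (mulB : {bilinear B -> B -> B}) (f : 'Hom(A, B)) : Prop :=
  bijective f /\ (forall x y : A, f (mulA x y) = mulB (f x) (f y)).

Definition isomorphic (A B : vectType R) (mulA : {bilinear A -> A -> A})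
    (mulB : {bilinear B -> B -> B}) : Prop :=
  exists f : 'Hom(A, B), alg_iso mulA mulB f.

End Algebras.

Section QuadraticAlgebras.
Variables (R : realType) (W : vectType R).

Definition quad_mul (form : {symmetric W}) (op : {bilinear W -> W -> W})
    (x y : (R^o * W)%type) : (R^o * W)%type :=
  (x.1 * y.1 + form x.2 y.2, x.1 *: y.2 + y.1 *: x.2 + op x.2 y.2).

Lemma quad_mul_is_bilinear form op :
  bilinear_for (GRing.Scale.Law.clone _ _ *:%R _)
    (GRing.Scale.Law.clone _ _ *:%R _) (quad_mul form op).
Proof.
split=> [[b y]|[b y]] a [c x] [d z]; congr (_, _) => /=.
- rewrite linearPl /= /GRing.scale /=; ring.
- rewrite linearPl /= !scalerDr !scalerDl !scalerA.
  rewrite [b * a]mulrC -!addrA; congr (_ + _).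
  by rewrite addrCA; congr (_ + _); rewrite [RHS]addrCA; congr (_ + _);
     rewrite addrCA.
- rewrite linearPr /= /GRing.scale /=; ring.
- rewrite linearPr /= !scalerDr !scalerDl !scalerA.
  rewrite [b * a]mulrC -!addrA; congr (_ + _).
  by rewrite addrCA; congr (_ + _); rewrite [RHS]addrCA; congr (_ + _);
     rewrite addrCA.
Qed.

HB.instance Definition _ form op :=
  bilinear_isBilinear.Build R (R^o * W)%type (R^o * W)%type (R^o * W)%type
    _ _ (quad_mul form op) (quad_mul_is_bilinear form op).

Definition tilde (s : 'End(W)) : 'End((R^o * W)%type) :=
  linfun (fun x : (R^o * W)%type => (x.1, s x.2)).

Lemma tildeE s x : tilde s x = (x.1, s x.2).
Proof.
have lin : linear (fun x : (R^o * W)%type => (x.1, s x.2)).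
  by move=> a [b u] [c v]; congr (_, _) => /=; rewrite linearP.
pose L := GRing.isLinear.Build _ _ _ _ _ lin.
pose f : {linear (R^o * W)%type -> (R^o * W)%type} :=
  HB.pack (fun x : (R^o * W)%type => (x.1, s x.2)) L.
exact: (lfunE f x).
Qed.

(* Only meaningful when [form] is nondegenerate, see [adjointP]. *)
Definition adjoint (form : {symmetric W}) (phi : 'End(W)) : 'End(W) :=
  xget 0 [set psi : 'End(W) |
    forall x y : W, form (phi x) y = form x (psi y)]%classic.

Lemma adjointP (form : {symmetric W}) (phi : 'End(W)) :
  (forall y, (forall x, form x y = 0) -> y = 0) ->
  forall x y, form (phi x) y = form x (adjoint form phi y).
Proof.
move=> nondeg; apply: (@xgetPex _ 0 [set psi : 'End(W) |
  forall x y, form (phi x) y = form x (psi y)]%classic).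
have linl y : linear (fun x => form x y : R^o).
  by move=> a u v /=; rewrite linearPl.
pose l y : {linear W -> R^o} :=
  HB.pack (fun x => form x y : R^o) (GRing.isLinear.Build _ _ _ _ _ (linl y)).
pose T0 y : 'Hom(W, R^o) := linfun (l y).
have T0E y x : T0 y x = form x y by rewrite lfunE.
have linT : linear T0.
  move=> a u v; apply/lfunP=> x; rewrite add_lfunE scale_lfunE !T0E.
  by rewrite linearPr.
pose T : 'Hom(W, 'Hom(W, R^o)) :=
  linfun (HB.pack T0 (GRing.isLinear.Build _ _ _ _ _ linT)
    : {linear W -> 'Hom(W, R^o)}).
have TE y x : T y x = form x y by rewrite lfunE /= T0E.
have kT : lker T = 0%VS.
  apply/eqP; rewrite -subv0; apply/subvP=> y; rewrite memv_ker => /eqP Ty.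
  by rewrite memv0; apply/eqP/nondeg=> x; rewrite -TE Ty zero_lfunE.
have fT : limg T = fullv.
  apply/eqP; rewrite eqEdim subvf limg_dim_eq ?kT ?capv0 // !dimvf.
  by rewrite /dim /= muln1.
have linP : linear (fun y => (T y \o phi)%VF).
  move=> a u v; apply/lfunP=> x.
  by rewrite add_lfunE scale_lfunE !comp_lfunE !TE linearPr.
pose P : 'Hom(W, 'Hom(W, R^o)) :=
  linfun (HB.pack (fun y => (T y \o phi)%VF)
    (GRing.isLinear.Build _ _ _ _ _ linP) : {linear W -> 'Hom(W, R^o)}).
exists (T^-1 \o P)%VF => x y /=.
by rewrite -[RHS]TE comp_lfunE limg_lfunVK ?fT ?memvf // lfunE /= comp_lfunE TE.
Qed.

Definition isotope (form : {symmetric W}) (op : {bilinear W -> W -> W})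
    (phi : 'End(W)) (x y : W) : W :=
  adjoint form phi (op (phi x) (phi y)).

Lemma isotope_is_bilinear form op phi :
  bilinear_for (GRing.Scale.Law.clone _ _ *:%R _)
    (GRing.Scale.Law.clone _ _ *:%R _) (isotope form op phi).
Proof.
by split=> [y|y] a x z; rewrite /isotope linearP ?linearPl ?linearPr linearP.
Qed.

HB.instance Definition _ form op phi :=
  bilinear_isBilinear.Build R W W W _ _ (isotope form op phi)
    (isotope_is_bilinear form op phi).

(* Symmetric positive definite automorphisms of the Euclidean space
   (W, - form). *)
Definition posdef_symmetric (form : {symmetric W}) (s : 'End(W)) : Prop :=
  [/\ bijective s,
      forall x y : W, form (s x) y = form x (s y) &
      forall x : W, x != 0 -> 0 < - form (s x) x].

End QuadraticAlgebras.

Section CayleyDickson.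
Variables (R : realType) (A : vectType R).
Variables (mul : {bilinear A -> A -> A}) (conj : {linear A -> A}).

(* (a, b) (c, d) = (a c - d^* b, d a + b c^* ) *)
Definition cd_mul (x y : (A * A)%type) : (A * A)%type :=
  (mul x.1 y.1 - mul (conj y.2) x.2, mul y.2 x.1 + mul x.2 (conj y.1)).

Definition cd_conj (x : (A * A)%type) : (A * A)%type := (conj x.1, - x.2).

Lemma cd_mul_is_bilinear :
  bilinear_for (GRing.Scale.Law.clone _ _ *:%R _)
    (GRing.Scale.Law.clone _ _ *:%R _) cd_mul.
Proof.
split=> [[b y]|[b y]] a [c x] [d z]; congr (_, _) => /=.
- by rewrite linearPl linearPr /= scalerBr opprD addrACA.
- by rewrite linearPl linearPr /= scalerDr addrACA.
- by rewrite linearPr linearP linearPl /= scalerBr opprD addrACA.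
- by rewrite linearPl linearP linearPr /= scalerDr addrACA.
Qed.

HB.instance Definition _ :=
  bilinear_isBilinear.Build R (A * A)%type (A * A)%type (A * A)%type
    _ _ cd_mul cd_mul_is_bilinear.

Lemma cd_conj_is_linear : linear cd_conj.
Proof.
move=> a [b x] [c y]; congr (_, _) => /=; first by rewrite linearP.
by rewrite opprD scalerN.
Qed.

HB.instance Definition _ :=
  GRing.isLinear.Build R (A * A)%type (A * A)%type _ cd_conj cd_conj_is_linear.

End CayleyDickson.

Section Octonions.
Variable R : realType.

Definition real_mul (x y : R^o) : R^o := x * y.

Lemma real_mul_is_bilinear :
  bilinear_for (GRing.Scale.Law.clone _ _ *:%R _)
    (GRing.Scale.Law.clone _ _ *:%R _) real_mul.
Proof.
by split=> x a y z; rewrite /real_mul /GRing.scale /=; ring.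
Qed.

HB.instance Definition _ :=
  bilinear_isBilinear.Build R R^o R^o R^o _ _ real_mul real_mul_is_bilinear.

Definition cplx : vectType R := (R^o * R^o)%type.
Definition quat : vectType R := (cplx * cplx)%type.
Definition oct : vectType R := (quat * quat)%type.

Definition cplx_mul : {bilinear cplx -> cplx -> cplx} :=
  cd_mul real_mul (@idfun R^o).
Definition cplx_conj : {linear cplx -> cplx} := cd_conj (@idfun R^o).
Definition quat_mul : {bilinear quat -> quat -> quat} :=
  cd_mul cplx_mul cplx_conj.
Definition quat_conj : {linear quat -> quat} := cd_conj cplx_conj.
Definition oct_mul : {bilinear oct -> oct -> oct} := cd_mul quat_mul quat_conj.

Lemma oct_mulPl a (x y z : oct) :
  oct_mul (a *: x + y) z = a *: oct_mul x z + oct_mul y z.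
Proof. by move: oct_mul => m; rewrite linearPl. Qed.

Lemma oct_mulPr a (x y z : oct) :
  oct_mul z (a *: x + y) = a *: oct_mul z x + oct_mul z y.
Proof. by move: oct_mul => m; rewrite linearPr. Qed.

Definition oct_one : oct := (((1, 0), 0), 0).
Definition oct_re (x : oct) : R^o := x.1.1.1.

Lemma oct_re_is_linear : linear oct_re.
Proof. by []. Qed.

HB.instance Definition _ :=
  GRing.isLinear.Build R oct R^o _ oct_re oct_re_is_linear.

Definition oct_im (x : oct) : oct := x - oct_re x *: oct_one.

Definition imO : {vspace oct} := lker (linfun oct_re).

Lemma imOP (x : oct) : (x \in imO) = (oct_re x == 0).
Proof. by rewrite memv_ker lfunE. Qed.

Lemma oct_im_in (x : oct) : oct_im x \in imO.
Proof.
by rewrite imOP /oct_im linearB linearZ /= /GRing.scale /= mulrN1 subrr.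
Qed.

Definition ImO : vectType R := subvs_of imO.

Definition octform (x y : ImO) : R := oct_re (oct_mul (vsval x) (vsval y)).

Definition wedge (x y : ImO) : ImO :=
  vsproj imO (oct_im (oct_mul (vsval x) (vsval y))).

Lemma wedgeE x y : vsval (wedge x y) = oct_im (oct_mul (vsval x) (vsval y)).
Proof. by rewrite vsprojK ?oct_im_in. Qed.

Lemma octform_is_bilinear :
  bilinear_for (GRing.Scale.Law.clone _ _ *%R _)
    (GRing.Scale.Law.clone _ _ (idfun \; *%R) _) octform.
Proof.
have valP a (u v : ImO) : vsval (a *: u + v) = a *: vsval u + vsval v.
  exact: linearP.
have reP a x y : oct_re (a *: x + y) = a * oct_re x + oct_re y by [].
by split=> x a y z; rewrite /octform valP ?oct_mulPl ?oct_mulPr reP.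
Qed.

HB.instance Definition _ :=
  bilinear_isBilinear.Build R ImO ImO R _ _ octform octform_is_bilinear.

Lemma octform_sym x y : octform x y = (-1) ^+ false * idfun (octform y x).
Proof.
rewrite /octform expr0 mul1r /oct_re /= /real_mul /=; ring.
Qed.

HB.instance Definition _ :=
  isHermitianSesquilinear.Build R ImO false idfun octform octform_sym.

Lemma wedge_is_bilinear :
  bilinear_for (GRing.Scale.Law.clone _ _ *:%R _)
    (GRing.Scale.Law.clone _ _ *:%R _) wedge.
Proof.
rewrite /wedge; move: oct_mul => m.
have imP a (x y : oct) : oct_im (a *: x + y) = a *: oct_im x + oct_im y.
  by rewrite /oct_im linearP scalerDl scalerBr scalerA addrACA opprD.
have prP a (x y : oct) :
    vsproj imO (a *: x + y) = a *: vsproj imO x + vsproj imO y by exact: linearP.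
have valP a (u v : ImO) : vsval (a *: u + v) = a *: vsval u + vsval v.
  exact: linearP.
by split=> x a y z; rewrite (valP a y z) ?linearPl ?linearPr imP prP.
Qed.

HB.instance Definition _ :=
  bilinear_isBilinear.Build R ImO ImO ImO _ _ wedge wedge_is_bilinear.

Lemma octform_def (x : ImO) : x != 0 -> octform x x < 0.
Proof.
move=> x0; have: oct_re (vsval x) == 0 by rewrite -imOP subvsP.
have: vsval x != 0 by rewrite (inj_eq val_inj x 0).
rewrite /octform; case: (vsval x) => [[[a b] [c d]] [[e f] [g h]]] {x x0}.
move=> nz /eqP a0; have {}a0 : a = 0 by exact: a0.
move: nz; rewrite {}a0 => nz.
set q := oct_re _.
have -> : q =
    - (b ^+ 2 + c ^+ 2 + d ^+ 2 + e ^+ 2 + f ^+ 2 + g ^+ 2 + h ^+ 2).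
  by rewrite /q /oct_re /= /real_mul /=; ring.
rewrite oppr_lt0 lt_def !addr_ge0 ?sqr_ge0 // andbT.
apply: contra_neq nz => /eqP; rewrite !paddr_eq0 ?addr_ge0 ?sqr_ge0 //.
rewrite !sqrf_eq0.
by do ![case/andP]; do !move=> /[swap] /eqP ->; move=> /eqP ->.
Qed.

Lemma octform_nondeg (y : ImO) : (forall x, octform x y = 0) -> y = 0.
Proof.
move=> y0; apply/eqP/negP=> /negP /octform_def.
by rewrite y0 ltxx.
Qed.

Lemma wedge_anticomm (x y : ImO) : wedge x y = - wedge y x.
Proof.
have valN (u : ImO) : vsval (- u) = - vsval u by exact: linearN.
have E : oct_im (oct_mul (vsval x) (vsval y)) =
    - oct_im (oct_mul (vsval y) (vsval x)).
  have: oct_re (vsval x) == 0 by rewrite -imOP subvsP.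
  have: oct_re (vsval y) == 0 by rewrite -imOP subvsP.
  case: (vsval x) (vsval y) => [[[a b] [c d]] [[e f] [g h]]].
  case=> [[[a' b'] [c' d']] [[e' f'] [g' h']]].
  move=> /eqP a0 /eqP a0'; have {}a0 : a' = 0 by exact: a0.
  have {}a0' : a = 0 by exact: a0'.
  rewrite {}a0 {}a0' /oct_im /oct_re.
  do !congr (_, _); rewrite /= /real_mul /GRing.scale /=; ring.
apply: subvs_inj; apply: (etrans (wedgeE x y)).
by rewrite E; apply: (etrans (congr1 -%R (esym (wedgeE y x)))); rewrite valN.
Qed.

(* The Cayley-Dickson octonion algebra is (ImO, octform, wedge). *)
Lemma oct_quad : isomorphic (quad_mul octform wedge) oct_mul.
Proof.
have vP a (u v : ImO) : vsval (a *: u + v) = a *: vsval u + vsval v.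
  exact: linearP.
have vD (u v : ImO) : vsval (u + v) = vsval u + vsval v by exact: linearD.
have vZ a (u : ImO) : vsval (a *: u) = a *: vsval u by exact: linearZ.
pose g (x : (R^o * ImO)%type) : oct := x.1 *: oct_one + vsval x.2.
have glin : linear g.
  move=> a [b u] [c v]; rewrite /g; cbn [fst snd].
  have -> : vsval (a *: (b, u) + (c, v)).2 = a *: vsval u + vsval v.
    exact: vP.
  have -> : (a *: (b, u) + (c, v)).1 = a * b + c by [].
  by rewrite scalerDl scalerDr scalerA addrACA.
pose f : 'Hom((R^o * ImO)%type, oct) :=
  linfun (HB.pack g (GRing.isLinear.Build _ _ _ _ _ glin)
    : {linear (R^o * ImO)%type -> oct}).
have fE x : f x = x.1 *: oct_one + vsval x.2 by rewrite lfunE.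
have reE a (u : ImO) : oct_re (a *: oct_one + vsval u) = a.
  have -> : oct_re (a *: oct_one + vsval u) = a * 1 + oct_re (vsval u) by [].
  have /eqP -> : oct_re (vsval u) == 0 by rewrite -imOP subvsP.
  by rewrite addr0 mulr1.
exists f; split.
  exists (fun y => (oct_re y, vsproj imO (oct_im y))) => [[a u]|y].
    by rewrite (fE (a, u)) /oct_im reE addrC addKr vsvalK.
  rewrite fE; cbn [fst snd].
  by rewrite (vsprojK (oct_im_in y)) /oct_im addrC subrK.
have oneP x : oct_mul oct_one x = x /\ oct_mul x oct_one = x.
  case: x => [[[a b] [c d]] [[e h] [i j]]]; split;
  by do !congr (_, _); rewrite /= /real_mul /=; ring.
move=> [a u] [b v]; rewrite (fE (a, u)) (fE (b, v)) fE; cbn [fst snd].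
have -> : (quad_mul octform wedge (a, u) (b, v)).1 =
    a * b + oct_re (oct_mul (vsval u) (vsval v)) by [].
have -> : vsval (quad_mul octform wedge (a, u) (b, v)).2 =
    a *: vsval v + b *: vsval u + oct_im (oct_mul (vsval u) (vsval v)).
  apply: etrans (vD (a *: v + b *: u) (wedge u v)) _.
  by rewrite (wedgeE u v) (vD (a *: v) (b *: u)) (vZ a v) (vZ b u).
have [one1 oner] : (forall x, oct_mul oct_one x = x) /\
  (forall x, oct_mul x oct_one = x) by split=> x; have [] := oneP x.
rewrite /oct_im; move: oct_mul one1 oner => m m1 mr.
move: (vsval u) (vsval v) => p q.
have -> : m (a *: oct_one + p) (b *: oct_one + q) =
    a *: (b *: oct_one + q) + (b *: p + m p q).
  by rewrite linearPl m1 linearPr mr.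
move: (m p q) => w; move: oct_one => e.
rewrite scalerDr scalerDl scalerA -!addrA; congr (_ + _).
by rewrite addrC -!addrA addNr addr0.
Qed.

Lemma oct_adjointP (phi : 'End(ImO)) (x y : ImO) :
  octform (phi x) y = octform x (adjoint octform phi y).
Proof. exact: (@adjointP _ _ octform phi octform_nondeg). Qed.

Definition octonion : {bilinear (R^o * ImO) -> (R^o * ImO) -> (R^o * ImO)} :=
  quad_mul octform wedge.

(* The product of O(phi). *)
Definition octonion_isotope (phi : 'End(ImO)) :
    {bilinear (R^o * ImO) -> (R^o * ImO) -> (R^o * ImO)} :=
  quad_mul octform (isotope octform wedge phi).

Definition G2 (f : 'End((R^o * ImO)%type)) : Prop := alg_iso octonion octonion f.

End Octonions.

(* Main.v *)
Require Import Defs.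
From HB Require Import structures.
From mathcomp Require Import all_boot all_order all_algebra reals.
From mathcomp Require Import boolp complex zify ring lra.
Set Implicit Arguments.
Unset Strict Implicit.
Unset Printing Implicit Defensive.
Import Order.TTheory GRing.Theory Num.Theory.
Local Open Scope ring_scope.

(* A local unit argument and the Peirce decomposition give a unit; power
   associativity then makes every element quadratic, so that A = R + V with a
   negative definite form on V and an alternating 3-form T(x,y,z) = (xy|z) such
   that T(x,y,.) = 0 only for dependent x, y. By explicit linear algebra any two
   such 3-forms on 7-dimensional spaces are equivalent; applied to T and to the
   3-form of O, this yields A = O(phi). The polar decomposition phi = s u reduces
   phi to a positive s. An isomorphism O(s') -> O(s) is an isometry g of W such
   that h = s g s'^-1 stabilizes the 3-form of O. Such an h is orthogonal: if e, f
   are orthogonal eigenvectors of h^* h with eigenvalues p, q, then e /\ f is one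
   with eigenvalue 1/(pq), which forces all eigenvalues to be 1. Uniqueness of the
   polar decomposition of s g = h s' gives g = h and s' = g^-1 s g. *)

(** * Real polynomials and cyclic vectors *)

(** Isotopy enters through [B (isotope B op phi x y) z = B (op (phi x) (phi y)) (phi z)]: the
    adjoint in the definition makes isotopy a pull-back of the 3-form, while the quadratic form
    stays fixed. A division algebra thus amounts to a negative definite form together with a 3-form,
    and the absence of zero divisors is the condition that [T(x, y, .) = 0] only for dependent
    arguments. All linear automorphisms act on the 3-forms, but only isometries are isomorphisms of
    algebras; this is why a positive [s] survives as an invariant. The obstacle is that [T] and the
    quadratic form are unrelated a priori: the normal form of [T] must be reached by changes of
    basis that ignore the metric, and the stabilizer of the octonion 3-form must be proved
    orthogonal. Over the reals an operator may lack eigenvectors; one substitute, a real factor of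
    degree at most two of an annihilating polynomial, serves both for the squares in A and for the
    spectral theorem. *)

Section RealPolynomials.

(** A complex root [a + ib] yields the factor: [X - a] if [b = 0], and [(X - a)^2 + b^2] otherwise.
    The latter divides [p] because the remainder is real of degree at most one and vanishes at a
    non-real number. *)
Lemma real_poly_factor (R : rcfType) (p : {poly R}) : (1 < size p)%N ->
  exists q r : {poly R}, p = r * q /\
    exists a b : R, q = 'X - a%:P \/
      (b != 0 /\ q = ('X - a%:P) ^+ 2 + (b ^+ 2)%:P).
Proof.
move=> sp.
have /closed_rootP[z] : size (map_poly (real_complex R) p) != 1%N.
  by rewrite size_map_poly; case: (size p) sp => [|[]].
case: z => a b rz.
have [b0|b0] := eqVneq b 0.
  move: rz; rewrite {}b0 => rz.
  have /factor_theorem[r ->] : root p a by rewrite -(fmorph_root (real_complex R)).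
  by exists ('X - a%:P), r; split=> //; exists a, 0; left.
set q := ('X - a%:P) ^+ 2 + (b ^+ 2)%:P.
have sq : size q = 3%N.
  rewrite size_polyDl ?size_exp_XsubC // size_polyC.
  by case: (_ != 0).
exists q, (p %/ q); split; last by exists a, b; right.
have rq : root (map_poly (real_complex R) q) (a +i* b)%C.
  rewrite /root rmorphD rmorphXn rmorphB /= map_polyX !map_polyC /=.
  rewrite !hornerE /=.
  by rewrite expr2; simpc; rewrite -expr2 addNr eqxx.
have rr : root (map_poly (real_complex R) (p %% q)) (a +i* b)%C.
  move: rz; rewrite {1}(divp_eq p q) rmorphD rmorphM rootE hornerD hornerM.
  by move/eqP: rq => ->; rewrite mulr0 add0r.
have sr : (size (p %% q)%R <= 2)%N by rewrite -ltnS -sq ltn_modp -size_poly_gt0 sq.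
rewrite [LHS](divp_eq p q).
suff -> : p %% q = 0 by rewrite addr0.
have e : p %% q = ((p %% q)`_1)%:P * 'X + ((p %% q)`_0)%:P.
  apply/polyP=> -[|[|i]]; rewrite coefD coefMX !coefC /= ?add0r ?addr0 //.
  by rewrite nth_default // (leq_trans sr).
move: rr; rewrite e rmorphD rmorphM /= map_polyX !map_polyC /= rootE !hornerE.
simpc; rewrite eq_complex /= mulf_eq0 (negbTE b0) orbF andbC.
by case/andP=> /eqP ->; rewrite mul0r add0r => /eqP ->; rewrite !raddf0 mul0r addr0.
Qed.

End RealPolynomials.

Section PolynomialOrbit.
Variables (R : realType) (E : vectType R) (D : 'End(E)).

(** This is the vector [p(D) w]. Being linear in [p], it lets a factorization of a polynomial
    annihilating [w] act on vectors. *)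
Definition orbit_eval (w : E) (p : {poly R}) : E :=
  \sum_(i < size p) p`_i *: iter i D w.

Lemma orbit_eval_widen n w (p : {poly R}) : (size p <= n)%N ->
  orbit_eval w p = \sum_(i < n) p`_i *: iter i D w.
Proof.
move=> sp; rewrite /orbit_eval (big_ord_widen n (fun i => p`_i *: iter i D w)) //.
rewrite big_mkcond; apply: eq_bigr => i _; case: ltnP => // h.
by rewrite nth_default ?scale0r.
Qed.

Lemma orbit_eval_linear w : linear (orbit_eval w).
Proof.
move=> a p q; set n := maxn (size p) (size q).
have sp : (size p <= n)%N by rewrite leq_maxl.
have sq : (size q <= n)%N by rewrite leq_maxr.
have sa : (size (a *: p) <= n)%N by apply: leq_trans (size_scale_leq _ _) sp.
rewrite !(@orbit_eval_widen n) //.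
  rewrite scaler_sumr -big_split; apply: eq_bigr => i _ /=.
  by rewrite coefD coefZ scalerDl scalerA.
by rewrite (leq_trans (size_polyD _ _)) // geq_max sa.
Qed.

HB.instance Definition _ w :=
  GRing.isLinear.Build R {poly R} E _ (orbit_eval w) (orbit_eval_linear w).

Lemma orbit_eval_MX w p : orbit_eval w (p * 'X) = D (orbit_eval w p).
Proof.
rewrite (@orbit_eval_widen (size p).+1); last first.
  by rewrite (leq_trans (size_polyMleq _ _)) // size_polyX addnC.
rewrite big_ord_recl coefMX /= scale0r add0r linear_sum.
by apply: eq_bigr => i _; rewrite coefMX linearZ.
Qed.

Lemma orbit_eval_XsubC w p a :
  orbit_eval w (p * ('X - a%:P)) = D (orbit_eval w p) - a *: orbit_eval w p.
Proof.
by rewrite mulrBr linearB /= orbit_eval_MX mulrC mul_polyC linearZ.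
Qed.

Lemma orbit_eval_annihilator w : exists2 p : {poly R}, p != 0 & orbit_eval w p = 0.
Proof.
pose n := (\dim {:E}).+1.
pose X := [tuple iter i D w | i < n].
have nX : ~ free X.
  by rewrite /free size_tuple => /eqP e; have := dimvS (subvf <<X>>%VS); rewrite e ltnn.
apply: contra_notP nX => h; apply/freeP => k; under eq_bigr do rewrite nth_mktuple.
move=> ks i; have [/polyP p0|p0] := eqVneq (\poly_(i < n) k (inord i)) 0.
  by have := p0 i; rewrite coef_poly ltn_ord coef0 inord_val.
case: h; exists (\poly_(i < n) k (inord i)) => //.
rewrite (@orbit_eval_widen n) ?size_poly // -[RHS]ks; apply: eq_bigr => j _.
by rewrite coef_poly ltn_ord inord_val.
Qed.

(* The real substitute for an eigenvector: a factor of degree at most two of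
   an annihilating polynomial of minimal degree. *)
Lemma orbit_quadratic w : w != 0 -> exists p a b,
  let u := orbit_eval w p in let v := D u - a *: u in
  u != 0 /\ ((v = 0) \/ (b != 0 /\ D v - a *: v = - b ^+ 2 *: u)).
Proof.
move=> w0.
have ex : exists n, `[< exists2 p : {poly R}, p != 0 & orbit_eval w p = 0 /\ size p = n >].
  have [p p0 pw] := orbit_eval_annihilator w.
  by exists (size p); apply/asboolP; exists p.
case: (ex_minnP ex) => n /asboolP[p p0 [pw sp]] min.
have s1 : (1 < size p)%N.
  rewrite ltnNge; apply: contra p0 => /size1_polyC e.
  move: pw; rewrite e -[_%:P]mulr1 mul_polyC linearZ /=.
  rewrite {1}/orbit_eval size_poly1 big_ord1 coef1 /= scale1r => /eqP.
  by rewrite scaler_eq0 (negbTE w0) orbF => /eqP ->; rewrite scale0r.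
have [q [r [e [a [b Hq]]]]] := real_poly_factor s1.
have r0 : r != 0 by apply: contraNneq p0 => r0; rewrite e r0 mul0r.
have q0 : q != 0 by apply: contraNneq p0 => q0; rewrite e q0 mulr0.
have sq : (1 < size q)%N.
  case: Hq => [->|[_ ->]]; first by rewrite size_XsubC.
  rewrite size_polyDl ?size_exp_XsubC // size_polyC.
  by case: (_ != 0).
exists r, a, b => u v; split.
  apply/negP=> /eqP ru; have := min (size r).
  rewrite -sp e size_mul // => /(_ _)/wrap[].
    by apply/asboolP; exists r.
  rewrite leqNgt => /negP; apply; case: (size q) sq => [|[|k]] // _.
  by rewrite !addnS /= ltnS leq_addr.
move: pw; rewrite e; case: Hq => [->|[b0 ->]].
  by rewrite orbit_eval_XsubC; left.
have e2 : orbit_eval w (r * (b ^+ 2)%:P) = b ^+ 2 *: u.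
  by rewrite mulrC mul_polyC linearZ.
rewrite mulrDr expr2 mulrA linearD /= e2 !orbit_eval_XsubC -/u -/v => /eqP.
by rewrite addr_eq0 => /eqP h; right; split=> //; rewrite h scaleNr.
Qed.

End PolynomialOrbit.

(** * Unit and quadratic structure of a Jordan division algebra *)

Section Separation.
Variables (R : realType) (E : vectType R).

(** Linear functionals turn an identity between vectors into one between real numbers, within reach
    of linear arithmetic; hypotheses are carried over with [congr1 f]. *)
Lemma scalar_separates (x y : E) : (forall f : {scalar E}, f x = f y) -> x = y.
Proof.
move=> h; rewrite (coord_vbasis (memvf x)) (coord_vbasis (memvf y)).
by apply: eq_bigr => i _; rewrite (h (coord (vbasis fullv) i)).
Qed.

End Separation.

Definition bilinE := (linearDl, linearDr, linearNl, linearNr, linearZl_LR,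
  linearZr_LR, linear0l, linear0r).
Definition scalarE (R : realType) (E : vectType R) (f : {scalar E}) :=
  (linear0 f, linearD f, linearN f, linearZ_LR f).

Ltac veq f := apply: scalar_separates => f; rewrite ?(scalarE f) /=.

Section JordanDivision.
Variables (R : realType) (A : vectType R) (mul : {bilinear A -> A -> A}).
Hypotheses (ncj : noncommutative_Jordan mul) (lda : linear_division mul).
Local Notation "x ** y" := (mul x y) (at level 40, left associativity).
Local Notation assoc := (associator mul).

Lemma flex_linear x y z : assoc x y z = - assoc z y x.
Proof.
have [h _] := ncj (x + z) y; have [hx _] := ncj x y; have [hz _] := ncj z y.
move: h hx hz; rewrite /associator !bilinE => h hx hz.
veq f; move: (congr1 f h) (congr1 f hx) (congr1 f hz); rewrite ?(scalarE f) /=; lra.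
Qed.

(** The difference of the Jordan identities at [x + z] and [x - z] keeps the terms of odd degree in
    [z]; the cubic term is the Jordan identity at [z], and the linear term remains. *)
Lemma jordan_linear x y z :
  assoc (x ** x) y z + assoc (x ** z + z ** x) y x = 0.
Proof.
have [_ h] := ncj (x + z) y; have [_ h'] := ncj (x - z) y.
have [_ hx] := ncj x y; have [_ hz] := ncj z y.
move: h h' hx hz; rewrite /associator !bilinE => h h' hx hz.
veq f; move: (congr1 f h) (congr1 f h') (congr1 f hx) (congr1 f hz).
rewrite ?(scalarE f) /=; lra.
Qed.

Lemma mul_eq0 x y : x ** y = 0 -> x = 0 \/ y = 0.
Proof.
move=> xy; have [->|x0] := eqVneq x 0; [by left|right].
have [/bij_inj inj _] := lda.2 x x0.
by apply: inj; rewrite xy linear0r.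
Qed.

Lemma mul_cancel_l x y z : x != 0 -> x ** y = x ** z -> y = z.
Proof. by move=> x0; have [/bij_inj inj _] := lda.2 x x0; apply: inj. Qed.

Lemma mul_cancel_r x y z : x != 0 -> y ** x = z ** x -> y = z.
Proof. by move=> x0; have [_ /bij_inj inj] := lda.2 x x0; apply: inj. Qed.

(** Bijectivity of right multiplication solves [e ** a = a]. Flexibility and the Jordan identity,
    after cancelling [a] on the right, give the relations for [a ** e] and [(a ** a) ** e]. The
    linearized Jordan identity at [a, e, e] then says [(a ** a) ** (e ** e) = a ** a], and [a ** a]
    cancels. *)
Lemma local_unit a : a != 0 -> exists e,
  [/\ e ** a = a, a ** e = a, e ** e = e & (a ** a) ** e = a ** a].
Proof.
move=> a0; have [_ [g _ gK]] := lda.2 a a0; exists (g a).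
set e := g a; have ea : e ** a = a := gK a.
have ae : a ** e = a.
  apply: (mul_cancel_r a0); have [h _] := ncj a e.
  by move/eqP: h; rewrite /associator subr_eq0 ea => /eqP.
have aae : (a ** a) ** e = a ** a.
  apply: (mul_cancel_r a0); have [_ h] := ncj a e.
  by move/eqP: h; rewrite /associator subr_eq0 ea => /eqP.
have aa0 : a ** a != 0 by apply/negP=> /eqP/mul_eq0[] /eqP; apply/negP.
split=> //; apply: (mul_cancel_l aa0).
have := jordan_linear a e e; rewrite ea ae /associator !bilinE.
rewrite !aae ea ae => h.
veq f; move: (congr1 f h); rewrite ?(scalarE f) /= ; lra.
Qed.

(* z^2 lies in the Peirce 1-space of e, and its local unit is that of z. *)
Lemma idempotent_half_space e z :
  e ** e = e -> e ** z + z ** e = z -> z = 0.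
Proof.
move=> ee hz; apply/eqP/negP=> /negP z0.
have e0 : e != 0.
  by apply: contraNneq z0 => e0; rewrite -hz e0 !bilinE addr0.
have [f [fz zf ff zzf]] := local_unit z0.
have := jordan_linear z e e; rewrite addrC [z ** e + _]addrC hz (ncj z e).1 add0r.
rewrite /associator ee => /subr0_eq/(mul_cancel_r e0) zze.
have zz0 : z ** z != 0 by apply/negP=> /eqP/mul_eq0[] /eqP; apply/negP.
have ef : e = f by apply: (mul_cancel_l zz0); rewrite zze zzf.
move/eqP: hz; rewrite ef fz zf -subr_eq0 addrK; exact/negP.
Qed.

(** With Peirce components [x = x1 + x_{1/2} + x0] relative to [e], the vector [y = x - S x] is
    [x0 - x1], so [e (e y) = e y], and cancelling [e] gives [e y = y]. Then [x + y] lies in the half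
    space, which is zero, so [x = - y]. *)
Lemma idempotent_unit e : e != 0 -> e ** e = e ->
  forall x, e ** x = x /\ x ** e = x.
Proof.
move=> e0 ee x; pose S x := e ** x + x ** e.
have [y yE] : exists y, y = x - S x by exists (x - S x).
have hfl z : e ** z - e ** (e ** z) = - ((z ** e) ** e - z ** e).
  by have := flex_linear e e z; rewrite /associator ee.
have ey : e ** y = y.
  apply: (mul_cancel_l e0).
  have := jordan_linear e e x; have := hfl (S x); have := hfl x.
  rewrite /associator !ee yE /S !bilinE => h1 h2 h3.
  veq f; move: (congr1 f h1) (congr1 f h2) (congr1 f h3).
  rewrite ?(scalarE f) /=; lra.
have ye : y ** e = y.
  apply: (mul_cancel_r e0); have := hfl y; rewrite !ey subrr => /eqP.
  by rewrite eq_sym oppr_eq0 subr_eq0 => /eqP.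
have xy : x + y = 0.
  apply: (idempotent_half_space ee); rewrite !bilinE ey ye addrACA -/(S x) yE.
  veq f; lra.
by have -> : x = - y; [apply/eqP; rewrite -addr_eq0 xy | rewrite !bilinE ey ye].
Qed.

Lemma division_unital : exists one, one != 0 /\
  forall x, one ** x = x /\ x ** one = x.
Proof.
have [[a a0] _] := lda; have [e [ea ae ee _]] := local_unit a0.
have e0 : e != 0 by apply: contraNneq a0 => e0; rewrite -ea e0 !bilinE.
by exists e; split=> //; apply: idempotent_unit.
Qed.

Variable one : A.
Hypotheses (one0 : one != 0) (oneP : forall x, one ** x = x /\ x ** one = x).
Let mul1l x : one ** x = x. Proof. exact: (oneP x).1. Qed.
Let mul1r x : x ** one = x. Proof. exact: (oneP x).2. Qed.

(* For n > 3, with a_k := x^(n-k) x^k, the Jordan identity gives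
   2 a_(k+1) = a_k + a_1. *)
Lemma power_associative x i j :
  iter i (mul x) one ** iter j (mul x) one = iter (i + j) (mul x) one.
Proof.
have [pw pwE] : exists pw : nat -> A, forall n, pw n = iter n (mul x) one.
  by exists (fun n => iter n (mul x) one).
have pwS n : pw n.+1 = x ** pw n by rewrite !pwE.
have pw0 : pw 0 = one by rewrite pwE.
have pw1 : pw 1%N = x by rewrite pwS pw0 mul1r.
rewrite -!pwE {pwE}.
move: {2}(i + j)%N (erefl (i + j)%N) => n; elim/ltn_ind: n i j => n IH i j e.
have {IH} IH k l : (k + l < n)%N -> pw k ** pw l = pw (k + l)%N.
  by move=> lt; apply: (IH _ lt).
case: i e => [|i]; first by rewrite pw0 mul1l.
case: j => [|j]; first by move=> _; rewrite pw0 mul1r addn0.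
case: i => [|i] e; first by rewrite pw1.
have [n' en] : exists n', n = n'.+3 by exists (i + j)%N; move: e; lia.
pose a k := pw (n - k)%N ** pw k.
have pwx k : (k.+1 < n)%N -> pw k ** x = pw k.+1.
  by move=> lt; have := IH k 1%N; rewrite pw1 addn1; apply.
have a1 : pw n'.+2 ** x = pw n.
  have /subr0_eq := (ncj x (pw n'.+1)).1.
  by rewrite -pwS (pwx n'.+1) ?en // -pwS.
have asym k : (k.+1 < n)%N -> a k.+1 = a (n - k.+1)%N.
  move=> lt; have [l el] : exists l, (n - k.+1 = l.+1)%N by exists (n - k.+2)%N; lia.
  have el' : (n - l.+1 = k.+1)%N by lia.
  rewrite /a el el'; have := flex_linear (pw k.+1) (pw l) x; rewrite /associator.
  have h1 : pw k.+1 ** pw l = pw n'.+2 by rewrite IH; [congr pw|]; lia.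
  have h2 : pw l ** pw k.+1 = pw n'.+2 by rewrite IH; [congr pw|]; lia.
  have h3 : pw l ** x = pw l.+1 by apply: pwx; lia.
  rewrite h1 h2 h3 -!pwS -en a1 => h.
  by veq f; move: (congr1 f h); rewrite ?(scalarE f) /=; lra.
have arec k : (k.+3 < n)%N ->
    a k.+1 - a (n - 2)%N + 2 *: (pw n - a (n - k.+2)%N) = 0.
  move=> lt; have [l el] : exists l, (n - k.+2 = l.+1)%N by exists (n - k.+3)%N; lia.
  have := jordan_linear x (pw l) (pw k.+1).
  have e2 : x ** x = pw 2 by rewrite pwS pw1.
  have h1 : pw k.+1 ** x = pw k.+2 by apply: pwx; lia.
  have h2 : pw 2 ** pw l = pw (n - k.+1)%N by rewrite IH; [congr pw|]; lia.
  have h3 : pw l ** pw k.+1 = pw (n - 2)%N by rewrite IH; [congr pw|]; lia.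
  have h4 : pw k.+2 ** pw l = pw n'.+2 by rewrite IH; [congr pw|]; lia.
  have h5 : pw l ** x = pw l.+1 by apply: pwx; lia.
  have h6 : (n - (n - 2) = 2)%N by lia.
  have h7 : (n - l.+1 = k.+2)%N by lia.
  rewrite /associator e2 -pwS h1 !linearDl h2 h3 h4 h5 a1 /a el h6 h7.
  by move=> h; veq f; move: (congr1 f h); rewrite ?(scalarE f) /=; lra.
case: j e => [|j] e.
  rewrite pw1 (_ : i.+2 + 1 = n)%N; last by lia.
  by rewrite (_ : i.+2 = n'.+2)%N; last by lia.
have n3 : (3 < n)%N by lia.
have an1 : a 1%N = pw n by rewrite /a en subn1 pw1 /= a1 en.
(* For [k = 0] both differences in the recurrence equal [a 1 - a (n - 2)], so three times this
   vector is zero. *)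
have an2 : a (n - 2)%N = pw n.
  have h := arec 0%N n3; move: h; rewrite an1 => h.
  by veq f; move: (congr1 f h); rewrite ?(scalarE f) /=; lra.
have ak k : (k.+2 < n)%N -> a k.+1 = pw n.
  elim: k => [|k IHk] lt; first exact: an1.
  have := arec k lt; rewrite an2 -asym ?IHk; try lia.
  by move=> h; veq f; move: (congr1 f h); rewrite ?(scalarE f) /=; lra.
have := ak j.+1; rewrite /a (_ : n - j.+2 = i.+2)%N; last by lia.
rewrite (_ : i.+2 + j.+2 = n)%N; last by lia.
by apply; lia.
Qed.

(** The candidates for the imaginary hyperplane; [b = 0] admits only the zero vector, as there are
    no zero divisors. That they form a subspace is the content of [imag_add]. *)
Definition imag u := exists b : R, u ** u = - b ^+ 2 *: one.

Lemma left_alternative_on_powers x p :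
  x ** (x ** orbit_eval (linfun (mul x)) one p) =
  (x ** x) ** orbit_eval (linfun (mul x)) one p.
Proof.
have itE i : iter i (linfun (mul x)) one = iter i (mul x) one.
  by elim: i => //= i ->; rewrite lfunE.
rewrite /orbit_eval !linear_sum; apply: eq_bigr => i _; rewrite /= itE.
have -> : x ** x = iter 2 (mul x) one by rewrite /= mul1r.
by rewrite !linearZr_LR power_associative.
Qed.

(** For [D] the left multiplication by [x], the vector [u] is a polynomial in [x] killed by [D - a]
    or by [(D - a)^2 + b^2]. Left alternativity on powers of [x] rewrites the second case as
    [(x - a)^2 u = - b^2 u], and [u] cancels. *)
Lemma scalar_plus_imag x : exists a, imag (x - a *: one).
Proof.
have [p [a [b]]] := @orbit_quadratic _ _ (linfun (mul x)) one one0.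
have := left_alternative_on_powers x p.
set u := orbit_eval _ _ _ => alt [u0]; rewrite !lfunE /= !bilinE alt => H.
exists a; case: H => [|[_]] h.
  exists 0; have : (x - a *: one) ** u = 0 by rewrite !bilinE mul1l.
  by case/mul_eq0=> [->|/eqP]; rewrite ?bilinE ?expr0n ?oppr0 ?scale0r // (negbTE u0).
exists b; apply: (mul_cancel_r u0); rewrite !bilinE !mul1l !mul1r.
by veq f; move: (congr1 f h); rewrite ?(scalarE f) /=; lra.
Qed.

Lemma imag_scale a u : imag u -> imag (a *: u).
Proof.
by case=> b h; exists (a * b); rewrite !bilinE h !scalerA; congr (_ *: _); ring.
Qed.

Lemma imag_real r : imag (r *: one) -> r = 0.
Proof.
case=> b; rewrite !bilinE mul1l scalerA => /eqP.
rewrite -subr_eq0 -scalerBl scaler_eq0 (negbTE one0) orbF opprK => /eqP h.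
by apply/eqP; rewrite -sqrf_eq0 expr2; apply/eqP; nra.
Qed.

Lemma imag_real_eq0 u r : imag u -> u = r *: one -> u = 0.
Proof. by move=> iu e; move: iu; rewrite e => /imag_real ->; rewrite scale0r. Qed.

Lemma imag_mul_real u c r : imag u -> c *: u = r *: one -> c = 0 \/ u = 0.
Proof.
move=> iu e; have [->|c0] := eqVneq c 0; [by left|right].
apply: (@imag_real_eq0 _ (c^-1 * r)) => //.
by rewrite -scalerA -e scalerA mulVf // scale1r.
Qed.

(** Squaring [v = (c/q) 1 - (p/q) u] shows that [2 (c/q) (p/q) u] is real. An imaginary [u]
    therefore vanishes, or one of [c] and [p] does. *)
Lemma imag_dependent u v p q c : imag u -> imag v -> q != 0 ->
  p *: u + q *: v = c *: one -> u = 0 \/ exists t, v = t *: u.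
Proof.
move=> iu iv q0 e.
have ev : v = (c / q) *: one - (p / q) *: u.
  apply: (scalerI q0); rewrite scalerBr !scalerA ![q * _]mulrC !divfK // -e.
  by rewrite addrC addKr.
have [c0|c0] := eqVneq c 0.
  by right; exists (- (p / q)); rewrite ev c0 mul0r scale0r sub0r scaleNr.
have [b hu] := iu; have [b' hv] := iv.
have : (2 * (c / q) * (p / q)) *: u =
    ((c / q) ^+ 2 + (p / q) ^+ 2 * (- b ^+ 2) + b' ^+ 2) *: one.
  move: hv; rewrite ev !bilinE hu !(mul1l, mul1r) => h.
  veq f; move: (congr1 f h); rewrite ?(scalarE f) /= => {}h; lra.
move/(imag_mul_real iu)=> [/eqP|]; last by left.
rewrite !mulf_eq0 pnatr_eq0 (negbTE c0) invr_eq0 (negbTE q0) !orbF /= => /eqP p0.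
right; exists 0; rewrite scale0r; apply: (@imag_real_eq0 _ (c / q)) => //.
by rewrite ev p0 mul0r scale0r subr0.
Qed.

(** Let [a] and [a'] be the real parts of [u + v] and [u - v]. Modulo reals their squares are
    [2 a (u + v)] and [2 a' (u - v)], while the sum of these squares is [2 u^2 + 2 v^2], a real. So
    [(a + a') u + (a - a') v] is real, and if [a] is not zero then [u] and [v] are proportional. *)
Lemma imag_add u v : imag u -> imag v -> imag (u + v).
Proof.
move=> iu iv; have [a [b h]] := scalar_plus_imag (u + v).
have [a' [b' h']] := scalar_plus_imag (u - v).
have mult t w : imag w -> imag (w + t *: w).
  by move=> iw; rewrite -{1}[w]scale1r -scalerDl; apply: imag_scale.
have [eu hu] := iu; have [ev hv] := iv.
have e : (a + a') *: u + (a - a') *: v =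
    (2 * - eu ^+ 2 + 2 * - ev ^+ 2 + a ^+ 2 + a' ^+ 2 + b ^+ 2 + b' ^+ 2) / 2 *: one.
  move: h h'; rewrite !bilinE !mul1l !mul1r hu hv => h h'.
  veq f; move: (congr1 f h) (congr1 f h'); rewrite ?(scalarE f) /= => {}h {}h'; lra.
have [a0|a0] := eqVneq a 0.
  by exists b; rewrite -h a0 scale0r !subr0.
have [q0|q0] := eqVneq (a - a') 0.
  have p0 : a + a' != 0 by apply: contra_neq a0 => p0; lra.
  move: e; rewrite addrC => /(imag_dependent iv iu p0)[->|[t ->]].
    by rewrite addr0.
  by rewrite addrC; apply: mult.
case: (imag_dependent iu iv q0 e) => [->|[t ->]]; first by rewrite add0r.
exact: mult.
Qed.

Definition re x : R^o := sval (cid (scalar_plus_imag x)).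

Lemma re_imag x : imag (x - re x *: one).
Proof. exact: svalP (cid (scalar_plus_imag x)). Qed.

Lemma re_unique x a : imag (x - a *: one) -> re x = a.
Proof.
move=> h; have := imag_add (imag_scale (-1) (re_imag x)) h.
rewrite scaleN1r opprB addrA subrK -scalerBl => /imag_real /eqP.
by rewrite subr_eq0 => /eqP.
Qed.

Lemma re_is_linear : linear re.
Proof.
move=> a x y; apply: re_unique.
have := imag_add (imag_scale a (re_imag x)) (re_imag y).
by congr imag; veq f; rewrite /GRing.scale /=; ring.
Qed.

HB.instance Definition _ := GRing.isLinear.Build R A R^o _ re re_is_linear.

Lemma re_one : re one = 1.
Proof.
by apply: re_unique; exists 0; rewrite scale1r subrr bilinE expr0n oppr0 scale0r.
Qed.

Lemma re_real r : re (r *: one) = r.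
Proof. by rewrite linearZ /= re_one /GRing.scale /= mulr1. Qed.

Lemma imagP u : imag u <-> re u = 0.
Proof.
split=> [iu|r0]; first by apply: re_unique; rewrite scale0r subr0.
by have := re_imag u; rewrite r0 scale0r subr0.
Qed.

Lemma imag_sq u : re u = 0 -> u ** u = re (u ** u) *: one.
Proof. by move/imagP=> [b ->]; rewrite re_real. Qed.

Lemma imag_sq_lt0 u : re u = 0 -> u != 0 -> re (u ** u) < 0.
Proof.
move/imagP=> [b h] u0; rewrite h re_real oppr_lt0 lt_def sqr_ge0 andbT.
apply: contraNneq u0 => b0; move: h; rewrite b0 oppr0 scale0r.
by case/mul_eq0=> ->.
Qed.

Lemma imag_anticomm u v : re u = 0 -> re v = 0 ->
  u ** v + v ** u = (re (u ** v) + re (v ** u)) *: one.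
Proof.
move=> ru rv; have ruv : re (u + v) = 0 by rewrite linearD /= ru rv addr0.
have := imag_sq ruv; rewrite !bilinE [X in X *: _]linearD /=.
rewrite [X in (X + _) *: _]linearD [X in (_ + X) *: _]linearD /=.
have := imag_sq ru; have := imag_sq rv; move: (re (u ** u)) (re (v ** v)) => s t.
move=> hs ht h; veq f; move: (congr1 f h) (congr1 f hs) (congr1 f ht).
rewrite ?(scalarE f) /=; lra.
Qed.

(** Written with [w], the flexible law [(u v) u = u (v u)] says that [(re (u v) - re (v u)) u]
    equals [- (u w + w u)], a real multiple of the unit. As [u] is imaginary both sides vanish: the
    left one gives the symmetry of the form, the right one the alternation of the 3-form. *)
Lemma imag_comm_aux u v (w := u ** v - re (u ** v) *: one) :
  re u = 0 -> re v = 0 ->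
  re (u ** v) = re (v ** u) /\ re (u ** w) + re (w ** u) = 0.
Proof.
move=> ru rv; have [->|u0] := eqVneq u 0.
  by rewrite !bilinE !linear0 addr0.
have rw : re w = 0 by rewrite linearB /= re_real subrr.
have huv : u ** v = w + re (u ** v) *: one by rewrite subrK.
have hvu : v ** u = re (v ** u) *: one - w.
  have := imag_anticomm ru rv; rewrite /w => h.
  by veq f; move: (congr1 f h); rewrite ?(scalarE f) /=; lra.
clearbody w; have := (ncj u v).1; rewrite /associator {1}huv {1}hvu !bilinE mul1l mul1r => h.
have := imag_anticomm ru rw; set c : R := re _ + re _ => hw.
have e : (re (u ** v) - re (v ** u)) *: u = - c *: one.
  by veq f; move: (congr1 f h) (congr1 f hw); rewrite ?(scalarE f) /=; lra.
have iu : imag u by apply/imagP.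
have uv : re (u ** v) = re (v ** u).
  case: (imag_mul_real iu e) => [/eqP|e0]; first by rewrite subr_eq0 => /eqP.
  by rewrite e0 eqxx in u0.
split=> //.
move/eqP: e; rewrite uv subrr scale0r eq_sym scaler_eq0 (negbTE one0) orbF.
by rewrite oppr_eq0 => /eqP.
Qed.

Lemma imag_comm u v : re u = 0 -> re v = 0 -> re (u ** v) = re (v ** u).
Proof. by move=> ru rv; have [] := imag_comm_aux ru rv. Qed.

Lemma re_mul3_eq0 u v : re u = 0 -> re v = 0 -> re ((u ** v) ** u) = 0.
Proof.
move=> ru rv; have [_] := imag_comm_aux ru rv.
set w := _ - _; have rw : re w = 0 by rewrite linearB /= re_real subrr.
have huv : u ** v = w + re (u ** v) *: one by rewrite subrK.
clearbody w; rewrite huv (imag_comm ru rw) !bilinE mul1l linearD linearZ /= ru.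
by rewrite /GRing.scale /= mulr0 addr0; lra.
Qed.

Definition triple u v w : R := re ((u ** v) ** w).

(** The imaginary part [w] of [u ** v] satisfies [re (w ** w) = triple u v w = 0], so [w = 0] by
    definiteness. Then [u ** v] is real, hence a multiple of [u ** u], and [u] cancels. *)
Lemma triple_nondegenerate u v : re u = 0 -> re v = 0 -> u != 0 ->
  (forall w, re w = 0 -> triple u v w = 0) -> exists c, v = c *: u.
Proof.
move=> ru rv u0 h; pose w := u ** v - re (u ** v) *: one.
have rw : re w = 0 by rewrite linearB /= re_real subrr.
have w0 : w = 0.
  apply/eqP/negP=> /negP /(imag_sq_lt0 rw).
  have huv : u ** v = w + re (u ** v) *: one by rewrite subrK.
  clearbody w; have := h w rw; rewrite /triple huv.
  rewrite !bilinE mul1l linearD linearZ /= rw /GRing.scale /= mulr0 addr0 => ->.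
  by rewrite ltxx.
have r0 := imag_sq_lt0 ru u0.
exists (re (u ** v) / re (u ** u)); apply: (mul_cancel_l u0).
rewrite linearZr_LR /= (imag_sq ru) scalerA re_real divfK ?lt_eqF //.
by apply/eqP; rewrite -subr_eq0; apply/eqP.
Qed.
End JordanDivision.

(** * Symmetric operators *)

Section LinearFunctionals.
Variables (R : realType) (W : vectType R).

Lemma lfun_of_linear (W' : vectType R) (f : W -> W') :
  linear f -> exists F : 'Hom(W, W'), F =1 f.
Proof.
move=> lin; exists (linfun (HB.pack f (GRing.isLinear.Build _ _ _ _ _ lin)
  : {linear W -> W'})) => x.
by rewrite lfunE.
Qed.

Lemma lker0_of_eq0 (W' : vectType R) (f : 'Hom(W, W')) :
  (forall x, f x = 0 -> x = 0) -> lker f == 0%VS.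
Proof.
by move=> f0; apply/lker0P=> x y e; apply/subr0_eq/f0; rewrite linearB /= e subrr.
Qed.

Variables (n : nat) (F : 'I_n -> W -> R).
Hypothesis linF : forall i, scalar (F i).

Let F0 i : F i 0 = 0.
Proof. by have := linF i (-1) 0 0; rewrite scaler0 addr0 mulN1r addNr. Qed.

Let combination (y : 'I_(\dim {:W}) -> R) i :
  F i (\sum_j y j *: (vbasis {:W})`_j) = \sum_j y j * F i (vbasis {:W})`_j.
Proof.
elim/big_rec2: _ => [|j a b _ <-]; first exact: F0.
by rewrite linF.
Qed.

Lemma common_zero : (n < \dim {:W})%N -> exists2 x, x != 0 & forall i, F i x = 0.
Proof.
move=> lt; pose K := \matrix_(j < \dim {:W}, i < n) F i (vbasis {:W})`_j.
have [y yK y0] : exists2 y : 'rV_(\dim {:W}), (y <= kermx K)%MS & y != 0.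
  apply/rowV0Pn; rewrite -mxrank_eq0 mxrank_ker -lt0n subn_gt0.
  exact: leq_ltn_trans (rank_leq_col _) lt.
exists (\sum_j y 0 j *: (vbasis {:W})`_j).
  apply: contra_neq y0 => e; apply/rowP=> j; rewrite mxE.
  by move/freeP: (basis_free (vbasisP {:W})) => /(_ (fun j => y 0 j) e j).
move=> i; rewrite combination; move/sub_kermxP/rowP/(_ i): yK; rewrite !mxE => yK.
by rewrite -[RHS]yK; apply: eq_bigr => j _; rewrite mxE.
Qed.

Lemma independent_functionals :
  (forall c : 'I_n -> R, (forall x, \sum_i c i * F i x = 0) -> forall i, c i = 0) ->
  forall v : 'I_n -> R, exists x, forall i, F i x = v i.
Proof.
move=> ind v; pose K := \matrix_(i < n, j < \dim {:W}) F i (vbasis {:W})`_j.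
have /row_freeP[N KN] : row_free K.
  rewrite -kermx_eq0; apply/eqP/row_matrixP=> k; rewrite row0.
  apply/rowP=> i; rewrite [RHS]mxE.
  have: row k (kermx K) *m K = 0 by rewrite -row_mul mulmx_ker row0.
  move: (row k _) => c cK; apply: (ind (fun i => c 0 i)) => x.
  rewrite (coord_vbasis (memvf x)).
  under eq_bigr do rewrite combination mulr_sumr.
  rewrite exchange_big big1 //= => j _; under eq_bigr do rewrite mulrCA.
  rewrite -mulr_sumr; move/rowP/(_ j): cK; rewrite !mxE => cK.
  by rewrite (_ : \sum_i _ = 0) ?mulr0 // -[RHS]cK; apply: eq_bigr => l _; rewrite mxE.
pose y := N *m \col_i v i.
exists (\sum_j y j 0 *: (vbasis {:W})`_j) => i; rewrite combination.
have /colP/(_ i) : K *m y = \col_i v i by rewrite mulmxA KN mul1mx.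
by rewrite !mxE => <-; apply: eq_bigr => j _; rewrite !mxE mulrC.
Qed.

End LinearFunctionals.

Section Euclidean.
Variables (R : realType) (W : vectType R) (B : {symmetric W}).
Hypothesis Bneg : forall x, x != 0 -> B x x < 0.

Lemma formC x y : B x y = B y x.
Proof. by rewrite hermC /= expr0 mul1r. Qed.
Lemma formDl x y z : B (x + y) z = B x z + B y z. Proof. exact: linearDl. Qed.
Lemma formZl a x z : B (a *: x) z = a * B x z. Proof. exact: linearZl_LR. Qed.
Lemma formNl x z : B (- x) z = - B x z. Proof. exact: linearNl. Qed.
Lemma form0l z : B 0 z = 0. Proof. exact: linear0l. Qed.
Lemma formDr x y z : B z (x + y) = B z x + B z y. Proof. exact: linearDr. Qed.
Lemma formZr a x z : B z (a *: x) = a * B z x. Proof. exact: linearZr_LR. Qed.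
Lemma formNr x z : B z (- x) = - B z x. Proof. exact: linearNr. Qed.
Lemma form0r z : B z 0 = 0. Proof. exact: linear0r. Qed.
Definition formE := (formDl, formZl, formNl, form0l, formDr, formZr, formNr, form0r).

Lemma form_suml I (r : seq I) (P : pred I) (f : I -> W) z :
  B (\sum_(i <- r | P i) f i) z = \sum_(i <- r | P i) B (f i) z.
Proof. by elim/big_rec2: _ => [|i a b _ <-]; rewrite ?form0l ?formDl. Qed.

Lemma form_le0 x : B x x <= 0.
Proof. by have [->|/Bneg/ltW//] := eqVneq x 0; rewrite form0l. Qed.

Lemma form_eq0 x : B x x = 0 -> x = 0.
Proof. by move=> e; apply/eqP/negP=> /negP/Bneg; rewrite e ltxx. Qed.

Lemma form_nondegenerate x : (forall y, B x y = 0) -> x = 0.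
Proof. by move=> /(_ x)/form_eq0. Qed.

Lemma form_separates x x' : (forall y, B x y = B x' y) -> x = x'.
Proof.
by move=> e; apply/subr0_eq/form_nondegenerate=> y; rewrite !formE e subrr.
Qed.

Definition form_symmetric (D : 'End(W)) := forall x y, B (D x) y = B x (D y).

(** [P] plays the role of an invariant subspace. In the quadratic case, [v = D u - a u] would
    satisfy [B v v = - b^2 * B u u] by symmetry of [D], and the two sides have incompatible
    signs. *)
Lemma symmetric_eigenvector (D : 'End(W)) (P : W -> Prop) w : form_symmetric D ->
  P 0 -> (forall a x y, P x -> P y -> P (a *: x + y)) -> (forall x, P x -> P (D x)) ->
  w != 0 -> P w -> exists u a, [/\ P u, u != 0 & D u = a *: u].
Proof.
move=> sD P0 Plin PD w0 Pw; have [p [a [b [u0]]]] := orbit_quadratic D w0.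
have Pu : P (orbit_eval D w p).
  rewrite /orbit_eval; elim/big_rec: _ => // i x _ Px; apply: Plin => //.
  by elim: (nat_of_ord i) => //= k; apply: PD.
move: (orbit_eval D w p) u0 Pu => u u0 Pu [/subr0_eq h|[b0 h]]; exists u, a; split=> //.
exfalso; have [v vE] : exists v, v = D u - a *: u by eexists.
rewrite -vE in h.
have : B v v = - b ^+ 2 * B u u.
  by rewrite -formZr -h {1}vE !formE sD.
have := form_le0 v; have := Bneg u0; have : 0 < b ^+ 2 by rewrite lt_def sqr_ge0 sqrf_eq0 b0.
by move=> ? ? ?; nra.
Qed.

(** Fewer than [\dim {:W}] eigenvectors have a nonzero orthogonal complement, and [D] preserves
    it. *)
Lemma eigenvector_orthogonal (D : 'End(W)) n (X : 'I_n -> W) (l : 'I_n -> R) :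
  form_symmetric D -> (n < \dim {:W})%N -> (forall i, D (X i) = l i *: X i) ->
  exists u a, [/\ forall i, B (X i) u = 0, u != 0 & D u = a *: u].
Proof.
move=> sD lt eX.
have [i a x y|w w0 Xw] := @common_zero _ _ n (fun i => B (X i)) _ lt.
  by rewrite !formE.
apply: (@symmetric_eigenvector D (fun u => forall i, B (X i) u = 0) w) => //.
- by move=> i; rewrite form0r.
- by move=> a x y hx hy i; rewrite !formE hx hy mulr0 addr0.
- by move=> x hx i; rewrite -sD eX formE hx mulr0.
Qed.

Lemma orthonormal_eigenvectors (D : 'End(W)) n : form_symmetric D ->
  (n <= \dim {:W})%N -> exists (X : 'I_n -> W) (l : 'I_n -> R),
  (forall i j, B (X i) (X j) = - (i == j)%:R) /\ forall i, D (X i) = l i *: X i.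
Proof.
move=> sD; elim: n => [|n IH] lt.
  by exists (fun=> 0), (fun=> 0); split; case.
have [X [l [oX eX]]] := IH (ltnW lt).
have [u [a [oXu u0 eu]]] := eigenvector_orthogonal sD lt eX.
pose c := (Num.sqrt (- B u u))^-1; have Bu := Bneg u0.
have cc : c * (c * B u u) = -1.
  rewrite mulrA -expr2 exprVn sqr_sqrtr; last by rewrite oppr_ge0 ltW.
  by rewrite invrN mulNr mulVf // lt_eqF.
exists (fun i => if unlift ord_max i is Some j then X j else c *: u).
exists (fun i => if unlift ord_max i is Some j then l j else a).
split=> [i j|i]; last first.
  by case: unliftP => [k|] _ //; rewrite linearZ /= eu !scalerA mulrC.
case: unliftP => [k ->|->]; case: unliftP => [k' ->|->].
- by rewrite oX (inj_eq lift_inj).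
- by rewrite eq_sym (negbTE (neq_lift _ _)) oppr0 formE oXu mulr0.
- by rewrite (negbTE (neq_lift _ _)) oppr0 formE formC oXu mulr0.
- by rewrite eqxx !formE.
Qed.

Lemma orthonormal_expansion n (X : 'I_n -> W) : n = \dim {:W} ->
  (forall i j, B (X i) (X j) = - (i == j)%:R) ->
  forall x, x = \sum_i (- B x (X i)) *: X i.
Proof.
move=> en oX x; pose T := [tuple X i | i < n].
have BX (k : 'I_n -> R) j : B (\sum_i k i *: X i) (X j) = - k j.
  rewrite form_suml (bigD1 j) //= big1 => [|i /negbTE ne].
    by rewrite formZl oX eqxx mulrN1 addr0.
  by rewrite formZl oX ne oppr0 mulr0.
have /span_basis sT : basis_of fullv T.
  rewrite basisEfree subvf size_tuple -en leqnn !andbT.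
  apply/freeP=> k; under eq_bigr do rewrite nth_mktuple.
  by move=> e j; have := BX k j; rewrite e form0l => /eqP; rewrite eq_sym oppr_eq0 => /eqP.
have /coord_span e : x \in <<T>>%VS by rewrite sT memvf.
rewrite {1}e; apply: eq_bigr => i _; rewrite nth_mktuple; congr (_ *: _).
have -> : B x (X i) = B (\sum_j coord T j x *: X j) (X i).
  by congr (B _ _); rewrite {1}e; apply: eq_bigr => j _; rewrite nth_mktuple.
by rewrite BX opprK.
Qed.

Lemma positive_square_root (P : 'End(W)) : form_symmetric P ->
  (forall x, x != 0 -> 0 < - B (P x) x) -> exists s : 'End(W),
  [/\ form_symmetric s, forall x, x != 0 -> 0 < - B (s x) x & forall x, s (s x) = P x].
Proof.
move=> sP posP; have [X [l [oX eX]]] := orthonormal_eigenvectors sP (leqnn _).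
have expand := orthonormal_expansion erefl oX.
have X0 i : X i != 0.
  by apply/negP=> /eqP e; have /eqP := oX i i; rewrite e form0l eqxx eq_sym oppr_eq0 oner_eq0.
have l0 i : 0 < l i by have := posP _ (X0 i); rewrite eX formE oX eqxx mulrN1 opprK.
(* Since [B (X i) (X i) = -1], the coordinate of [x] along [X i] is [- B x (X i)]. *)
have lin : linear (fun x => \sum_i (- B x (X i) * Num.sqrt (l i)) *: X i).
  move=> a x y; rewrite scaler_sumr -big_split; apply: eq_bigr => i _ /=.
  by rewrite scalerA -scalerDl !formE; congr (_ *: _); ring.
have [s sE] := lfun_of_linear lin.
have sX i : s (X i) = Num.sqrt (l i) *: X i.
  rewrite sE (bigD1 i) //= big1 => [|j /negbTE ne].
    by rewrite oX eqxx opprK mul1r addr0.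
  by rewrite oX eq_sym ne oppr0 oppr0 mul0r scale0r.
have Bs x y : B (s x) y = - \sum_i B x (X i) * Num.sqrt (l i) * B y (X i).
  rewrite sE form_suml -sumrN; apply: eq_bigr => i _.
  by rewrite formE [B (X i) y]formC; ring.
exists s; split.
- move=> x y; rewrite Bs [RHS]formC Bs; congr (- _); apply: eq_bigr => i _; ring.
- move=> x x0; rewrite Bs opprK lt_def; apply/andP; split.
    apply: contra_neq x0 => /eqP; rewrite psumr_eq0.
      move=> /allP h; rewrite (expand x) big1 // => i _.
      have := h i (mem_index_enum _); rewrite /= mulrAC -expr2 mulf_eq0 sqrf_eq0.
      rewrite [Num.sqrt _ == _]gt_eqF ?sqrtr_gt0 // orbF => /eqP ->.
      by rewrite oppr0 scale0r.
    by move=> i _; rewrite mulrAC -expr2 mulr_ge0 ?sqr_ge0 ?sqrtr_ge0.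
  by apply: sumr_ge0 => i _; rewrite mulrAC -expr2 mulr_ge0 ?sqr_ge0 ?sqrtr_ge0.
- move=> x; rewrite (expand x) !linear_sum; apply: eq_bigr => i _ /=.
  rewrite !linearZ /= sX linearZ /= sX eX; congr (_ *: _).
  by rewrite scalerA -expr2 sqr_sqrtr ?ltW.
Qed.

(** A nonzero image of [D] would be an invariant subspace containing an eigenvector [u = D y]. Its
    eigenvalue is zero, so [B u u = B y (D u) = 0]. *)
Lemma symmetric_eq0 (D : 'End(W)) : form_symmetric D ->
  (forall u a, u != 0 -> D u = a *: u -> a = 0) -> D = 0.
Proof.
move=> sD eig; apply/lfunP=> x; rewrite zero_lfunE; apply/eqP/negP=> /negP Dx0.
have [||||u [a [[y ey] u0 eu]]] :=
  @symmetric_eigenvector D (fun u => exists y, u = D y) _ sD _ _ _ Dx0.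
- by exists 0; rewrite linear0.
- by move=> a _ _ [x1 ->] [x2 ->]; exists (a *: x1 + x2); rewrite linearP.
- by move=> _ [z ->]; exists (D z).
- by exists x.
have := form_eq0 (x := u); rewrite {2}ey -sD eu (eig u a u0 eu) scale0r form0l.
by move=> /(_ erefl)/eqP; apply/negP.
Qed.

(** For [D = s - t] the equality of squares reads [s D + D t = 0]. On an eigenvector [u] of [D] with
    eigenvalue [a] this gives [a (B (s u) u + B (t u) u) = 0], where the bracket is negative. *)
Lemma positive_square_root_unique (s t : 'End(W)) :
  form_symmetric s -> (forall x, x != 0 -> 0 < - B (s x) x) ->
  form_symmetric t -> (forall x, x != 0 -> 0 < - B (t x) x) ->
  (forall x, s (s x) = t (t x)) -> s = t.
Proof.
move=> ss ps st pt e; pose D := s - t.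
have DE x : D x = s x - t x by rewrite add_lfunE opp_lfunE.
have sD : form_symmetric D by move=> x y; rewrite !DE !formE ss st.
apply/subr0_eq/symmetric_eq0 => // u a u0; rewrite -/D => eu.
have : a * (B (s u) u + B (t u) u) = 0.
  have h1 : B (s (D u)) u + B (D (t u)) u = 0.
    by rewrite -formDl !DE linearB /= e addrA subrK subrr form0l.
  move: h1; rewrite sD eu linearZ /= !formE => <-; ring.
move/eqP; rewrite mulf_eq0 => /orP[/eqP //|/eqP h].
by have := ps _ u0; have := pt _ u0; lra.
Qed.

End Euclidean.

Lemma euclidean_isometry (R : realType) (W W' : vectType R)
    (B : {symmetric W}) (B' : {symmetric W'}) :
  (forall x, x != 0 -> B x x < 0) -> (forall x, x != 0 -> B' x x < 0) ->
  \dim {:W} = \dim {:W'} ->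
  exists f : 'Hom(W, W'), forall x y, B' (f x) (f y) = B x y.
Proof.
move=> Bneg Bneg' ed.
have id_sym (V : vectType R) (F : {symmetric V}) : form_symmetric F \1%VF.
  by move=> x y; rewrite !id_lfunE.
(* Orthonormal bases are obtained as eigenvectors of the identity. *)
have [X [_ [oX _]]] := orthonormal_eigenvectors Bneg (id_sym _ _) (leqnn _).
have le : (\dim {:W} <= \dim {:W'})%N by rewrite ed.
have [Y [_ [oY _]]] := orthonormal_eigenvectors Bneg' (id_sym _ _) le.
have expand := orthonormal_expansion erefl oX.
have lin : linear (fun x => \sum_i (- B x (X i)) *: Y i).
  move=> a x y; rewrite scaler_sumr -big_split; apply: eq_bigr => i _ /=.
  by rewrite scalerA -scalerDl !formE; congr (_ *: _); ring.
have [f fE] := lfun_of_linear lin; exists f => x y.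
rewrite [in RHS](expand x) form_suml fE form_suml; apply: eq_bigr => i _.
rewrite !formZl; congr (_ * _); rewrite fE formC form_suml (bigD1 i) //= big1.
  by rewrite formZl oY eqxx addr0 mulrN1 opprK formC.
by move=> j /negbTE ne; rewrite formZl oY ne oppr0 mulr0.
Qed.

(** * Alternating 3-forms in dimension seven *)

Section ThreeForms.
Variables (R : realType) (W : vectType R).

Record alternating (T : W -> W -> W -> R) : Prop := Alternating {
  alt_linear1 : forall a x x' y z, T (a *: x + x') y z = a * T x y z + T x' y z;
  alt_linear2 : forall a x x' y z, T y (a *: x + x') z = a * T y x z + T y x' z;
  alt_linear3 : forall a x x' y z, T y z (a *: x + x') = a * T y z x + T y z x';
  alt12 : forall x z, T x x z = 0;
  alt23 : forall x z, T x z z = 0 }.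

(** For [T x y z = B (op x y) z] with definite [B], this says that [op x y] vanishes only for
    dependent [x] and [y], which is the division property of the quadratic algebra. *)
Definition nondegenerate (T : W -> W -> W -> R) :=
  forall x y, x != 0 -> (forall z, T x y z = 0) -> exists c, y = c *: x.

Variable T : W -> W -> W -> R.
Hypotheses (altT : alternating T) (ndT : nondegenerate T) (dimW : \dim {:W} = 7%N).

Lemma altD1 x x' y z : T (x + x') y z = T x y z + T x' y z.
Proof. by rewrite -[x]scale1r (alt_linear1 altT) mul1r scale1r. Qed.
Lemma altD2 x x' y z : T y (x + x') z = T y x z + T y x' z.
Proof. by rewrite -[x]scale1r (alt_linear2 altT) mul1r scale1r. Qed.
Lemma altD3 x x' y z : T y z (x + x') = T y z x + T y z x'.
Proof. by rewrite -[x]scale1r (alt_linear3 altT) mul1r scale1r. Qed.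
Lemma alt01 y z : T 0 y z = 0.
Proof. by have := altD1 0 0 y z; rewrite addr0; lra. Qed.
Lemma alt02 y z : T y 0 z = 0.
Proof. by have := altD2 0 0 y z; rewrite addr0; lra. Qed.
Lemma alt03 y z : T y z 0 = 0.
Proof. by have := altD3 0 0 y z; rewrite addr0; lra. Qed.
Lemma altZ1 a x y z : T (a *: x) y z = a * T x y z.
Proof. by rewrite -[a *: x]addr0 (alt_linear1 altT) alt01 addr0. Qed.
Lemma altZ2 a x y z : T y (a *: x) z = a * T y x z.
Proof. by rewrite -[a *: x]addr0 (alt_linear2 altT) alt02 addr0. Qed.
Lemma altZ3 a x y z : T y z (a *: x) = a * T y z x.
Proof. by rewrite -[a *: x]addr0 (alt_linear3 altT) alt03 addr0. Qed.
Lemma altC12 x y z : T y x z = - T x y z.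
Proof.
have := alt12 altT (x + y) z; rewrite altD1 !altD2 !(alt12 altT); lra.
Qed.
Lemma altC23 x y z : T x z y = - T x y z.
Proof.
have := alt23 altT x (y + z); rewrite altD2 !altD3 !(alt23 altT); lra.
Qed.
Lemma alt13 x y : T x y x = 0.
Proof. by rewrite altC23 (alt12 altT) oppr0. Qed.

Section Frame.
Variables x y z n0 n1 n2 n3 : W.

(** Entries beyond the end of a list read as 0, so short lists such as [[:: 0; 1]] denote basis
    vectors and a change of frame is a family of lists. *)
Definition vec (a : seq R) : W :=
  a`_0 *: x + a`_1 *: y + a`_2 *: z + a`_3 *: n0 + a`_4 *: n1 + a`_5 *: n2 + a`_6 *: n3.

(** The 3-form [e^i /\ e^j /\ e^k] of the dual basis. *)
Definition det3 (a b c : seq R) i j k : R :=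
  a`_i * (b`_j * c`_k - b`_k * c`_j) - a`_j * (b`_i * c`_k - b`_k * c`_i)
  + a`_k * (b`_i * c`_j - b`_j * c`_i).

(** Indices 0, 1, 2 belong to [x], [y], [z] and 3, ..., 6 to [n0], ..., [n3]. The pairs (5,6),
    (6,4), (4,5) are in cyclic order, so that the nine coefficients form a matrix. *)
Definition model mu m11 m12 m13 m21 m22 m23 m31 m32 m33 t0 t1 t2 t3
    (a b c : seq R) : R :=
  mu * det3 a b c 0 1 2 + det3 a b c 0 3 4 + det3 a b c 1 3 5 + det3 a b c 2 3 6
  + m11 * det3 a b c 0 5 6 + m12 * det3 a b c 0 6 4 + m13 * det3 a b c 0 4 5
  + m21 * det3 a b c 1 5 6 + m22 * det3 a b c 1 6 4 + m23 * det3 a b c 1 4 5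
  + m31 * det3 a b c 2 5 6 + m32 * det3 a b c 2 6 4 + m33 * det3 a b c 2 4 5
  + t0 * det3 a b c 4 5 6 + t1 * det3 a b c 3 5 6 + t2 * det3 a b c 3 6 4
  + t3 * det3 a b c 3 4 5.

Variables mu m11 m12 m13 m21 m22 m23 m31 m32 m33 t0 t1 t2 t3 : R.

(* T(u, v, n) = 0 for u, v in <x, y, z> and n in N := <n0, n1, n2, n3>;
   T(x, ., .), T(y, ., .), T(z, ., .) restrict on N to
   n0 /\ ni + mi1 n2 /\ n3 + mi2 n3 /\ n1 + mi3 n1 /\ n2, whose Pfaffian is mii,
   and t0, ..., t3 are the coefficients of T on N. *)
Record frame : Prop := Frame {
  f_mu : mu != 0; f_xyz : T x y z = mu;
  f_xy0 : T x y n0 = 0; f_xy1 : T x y n1 = 0; f_xy2 : T x y n2 = 0; f_xy3 : T x y n3 = 0;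
  f_yz0 : T y z n0 = 0; f_yz1 : T y z n1 = 0; f_yz2 : T y z n2 = 0; f_yz3 : T y z n3 = 0;
  f_zx0 : T z x n0 = 0; f_zx1 : T z x n1 = 0; f_zx2 : T z x n2 = 0; f_zx3 : T z x n3 = 0;
  f_x01 : T x n0 n1 = 1; f_x02 : T x n0 n2 = 0; f_x03 : T x n0 n3 = 0;
  f_y01 : T y n0 n1 = 0; f_y02 : T y n0 n2 = 1; f_y03 : T y n0 n3 = 0;
  f_z01 : T z n0 n1 = 0; f_z02 : T z n0 n2 = 0; f_z03 : T z n0 n3 = 1;
  f_x23 : T x n2 n3 = m11; f_x31 : T x n3 n1 = m12; f_x12 : T x n1 n2 = m13;
  f_y23 : T y n2 n3 = m21; f_y31 : T y n3 n1 = m22; f_y12 : T y n1 n2 = m23;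
  f_z23 : T z n2 n3 = m31; f_z31 : T z n3 n1 = m32; f_z12 : T z n1 n2 = m33;
  f_123 : T n1 n2 n3 = t0; f_023 : T n0 n2 n3 = t1; f_031 : T n0 n3 n1 = t2;
  f_012 : T n0 n1 n2 = t3 }.

Hypothesis F : frame.

Let rot a b c : T b c a = T a b c.
Proof. by rewrite altC23 altC12 opprK. Qed.
Let rot' a b c : T c a b = T a b c.
Proof. by rewrite altC12 altC23 opprK. Qed.
Let rev1 a b c : T b a c = - T a b c. Proof. exact: altC12. Qed.
Let rev2 a b c : T a c b = - T a b c. Proof. exact: altC23. Qed.
Let rev3 a b c : T c b a = - T a b c. Proof. by rewrite altC12 rot. Qed.

Let six a b c v : T a b c = v -> (T a b c = v) * (T b c a = v) * (T c a b = v) *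
  (T b a c = - v) * (T a c b = - v) * (T c b a = - v).
Proof.
by move=> <-; rewrite (rot a b c) (rot' a b c) (rev1 a b c) (rev2 a b c) (rev3 a b c).
Qed.

Let values := (
  six (f_xyz F), six (f_xy0 F), six (f_xy1 F), six (f_xy2 F), six (f_xy3 F),
   six (f_yz0 F), six (f_yz1 F), six (f_yz2 F), six (f_yz3 F), six (f_zx0
   F), six (f_zx1 F), six (f_zx2 F), six (f_zx3 F), six (f_x01 F), six
   (f_x02 F), six (f_x03 F), six (f_y01 F), six (f_y02 F), six (f_y03 F),
   six (f_z01 F), six (f_z02 F), six (f_z03 F), six (f_x23 F), six (f_x31
   F), six (f_x12 F), six (f_y23 F), six (f_y31 F), six (f_y12 F), six
   (f_z23 F), six (f_z31 F), six (f_z12 F), six (f_123 F), six (f_023 F),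
   six (f_031 F), six (f_012 F)).

Local Notation mdl := (model mu m11 m12 m13 m21 m22 m23 m31 m32 m33 t0 t1 t2 t3).

Lemma frame_model a b c : T (vec a) (vec b) (vec c) = mdl a b c.
Proof.
have l e : T e (vec b) (vec c) =
  b`_0 * T e x (vec c) + b`_1 * T e y (vec c) + b`_2 * T e z (vec c) +
  b`_3 * T e n0 (vec c) + b`_4 * T e n1 (vec c) + b`_5 * T e n2 (vec c) +
  b`_6 * T e n3 (vec c) by rewrite {1}/vec !altD2 !altZ2.
have r e e' : T e e' (vec c) =
  c`_0 * T e e' x + c`_1 * T e e' y + c`_2 * T e e' z +
  c`_3 * T e e' n0 + c`_4 * T e e' n1 + c`_5 * T e e' n2 +
  c`_6 * T e e' n3 by rewrite /vec !altD3 !altZ3.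
have diag := (alt12 altT, alt13, alt23 altT).
have tx : T x (vec b) (vec c) = mdl [:: 1] b c.
  by rewrite l !r !diag !values /model /det3 /=; ring.
have ty : T y (vec b) (vec c) = mdl [:: 0; 1] b c.
  by rewrite l !r !diag !values /model /det3 /=; ring.
have tz : T z (vec b) (vec c) = mdl [:: 0; 0; 1] b c.
  by rewrite l !r !diag !values /model /det3 /=; ring.
have tn0 : T n0 (vec b) (vec c) = mdl [:: 0; 0; 0; 1] b c.
  by rewrite l !r !diag !values /model /det3 /=; ring.
have tn1 : T n1 (vec b) (vec c) = mdl [:: 0; 0; 0; 0; 1] b c.
  by rewrite l !r !diag !values /model /det3 /=; ring.
have tn2 : T n2 (vec b) (vec c) = mdl [:: 0; 0; 0; 0; 0; 1] b c.
  by rewrite l !r !diag !values /model /det3 /=; ring.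
have tn3 : T n3 (vec b) (vec c) = mdl [:: 0; 0; 0; 0; 0; 0; 1] b c.
  by rewrite l !r !diag !values /model /det3 /=; ring.
rewrite {1}/vec !altD1 !altZ1 tx ty tz tn0 tn1 tn2 tn3 /model /det3 /=; ring.
Qed.

(** Contracting [T] with seven pairs of frame vectors gives a triangular system in the coordinates,
    so the values of [T] alone force a frame to be independent. *)
Lemma frame_coordinates a : vec a = 0 -> forall i, (i < 7)%N -> a`_i = 0.
Proof.
move=> a0; have h b c : mdl a b c = 0 by rewrite -frame_model a0 alt01.
have := h [:: 0; 1] [:: 0; 0; 1]; have := h [:: 0; 0; 1] [:: 1].
have := h [:: 1] [:: 0; 1].
have := h [:: 1] [:: 0; 0; 0; 1]; have := h [:: 0; 1] [:: 0; 0; 0; 1].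
have := h [:: 0; 0; 1] [:: 0; 0; 0; 1]; have := h [:: 1] [:: 0; 0; 0; 0; 1].
rewrite /model /det3 /= => h3 h6 h5 h4 h2 h1 h0.
suff : [/\ a`_0 = 0, a`_1 = 0, a`_2 = 0 & [/\ a`_3 = 0, a`_4 = 0, a`_5 = 0 & a`_6 = 0]].
  by move=> [? ? ? [? ? ? ?]]; case=> [|[|[|[|[|[|[|i]]]]]]].
move: h3 h6 h5 h4 h2 h1 h0.
move: (a`_0) (a`_1) (a`_2) (a`_3) (a`_4) (a`_5) (a`_6) => u0 u1 u2 u3 u4 u5 u6.
move=> h3 h6 h5 h4 h2 h1 h0; have mu0 := f_mu F.
have u4_0 : u4 = 0 by lra.
have u5_0 : u5 = 0 by lra.
have u6_0 : u6 = 0 by lra.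
have u3_0 : u3 = 0 by move: h3; rewrite u4_0 u5_0 u6_0; lra.
by do !split=> //; apply: (mulfI mu0); rewrite mulr0; lra.
Qed.

Lemma frame_span w : exists2 a, size a = 7%N & w = vec a.
Proof.
pose X := [tuple x; y; z; n0; n1; n2; n3].
have vecE (k : 'I_7 -> R) :
    \sum_(i < 7) k i *: X`_i = vec (mkseq (fun i => k (inord i)) 7).
  transitivity (\sum_(i < 7) k (inord i) *: X`_i).
    by apply: eq_bigr => i _; rewrite inord_val.
  by rewrite !big_ord_recr big_ord0 /= add0r.
have /span_basis sX : basis_of fullv X.
  rewrite basisEfree subvf size_tuple dimW leqnn !andbT.
  apply/freeP=> k; rewrite vecE => /frame_coordinates h i.
  by have := h i (ltn_ord i); rewrite nth_mkseq // inord_val.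
have /coord_span e : w \in <<X>>%VS by rewrite sX memvf.
exists (mkseq (fun i => coord X (inord i) w) 7); first by rewrite size_mkseq.
by rewrite {1}e vecE.
Qed.

Lemma frame_kernel a b i : (i < 7)%N -> a`_i != 0 ->
  (forall c, mdl a b c = 0) -> exists k, forall j, (j < 7)%N -> b`_j = k * a`_j.
Proof.
move=> i7 ai h; have va0 : vec a != 0.
  by apply: contra_neq ai => /frame_coordinates; apply.
have [k e] : exists k, vec b = k *: vec a.
  by apply: ndT va0 _ => w; have [c _ ->] := frame_span w; rewrite frame_model.
exists k => j j7.
have : vec (mkseq (fun l => b`_l - k * a`_l) 7) = 0.
  rewrite -(subrr (vec b)) {2}e /vec /=.
  veq f; ring.
by move/frame_coordinates/(_ j j7); rewrite nth_mkseq // => /subr0_eq.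
Qed.

End Frame.
End ThreeForms.

(** * Reduction of a nondegenerate 3-form to diagonal shape *)

Section NormalForm.
Variables (R : realType) (W : vectType R) (T : W -> W -> W -> R).
Hypotheses (altT : alternating T) (ndT : nondegenerate T) (dimW : \dim {:W} = 7%N).

(** Three functionals on a 7-dimensional space share a nonzero zero [n0]. The six functionals [g]
    are independent: evaluation at [x], [y], [z] kills the first three coefficients, and the others
    give a [u] in the span of [x], [y], [z] with [T(u, n0, .) = 0], so [u] is a multiple of [n0] and
    is killed by the first three functionals. Prescribing the values of [g] then yields [n1], [n2],
    [n3]. *)
Lemma frame_exists x y z : T x y z != 0 ->
  exists n0 n1 n2 n3 m11 m12 m13 m21 m22 m23 m31 m32 m33 t0 t1 t2 t3,
  frame T x y z n0 n1 n2 n3 (T x y z)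
    m11 m12 m13 m21 m22 m23 m31 m32 m33 t0 t1 t2 t3.
Proof.
move=> mu0.
have diag := (alt12 altT, alt13 altT, alt23 altT).
pose f (i : 'I_3) w := [:: T y z w; T z x w; T x y w]`_i.
have linf i : scalar (f i).
  by case: i => [[|[|[|i]]] lt] //= a u v; rewrite /f /= (alt_linear3 altT).
have [n0 n00 fn0] : exists2 n0, n0 != 0 & forall i, f i n0 = 0.
  by apply: common_zero; rewrite ?dimW.
have yz0 : T y z n0 = 0 := fn0 (@Ordinal 3 0 isT).
have zx0 : T z x n0 = 0 := fn0 (@Ordinal 3 1 isT).
have xy0 : T x y n0 = 0 := fn0 (@Ordinal 3 2 isT).
pose g i w := [:: T y z w; T z x w; T x y w; T x n0 w; T y n0 w; T z n0 w]`_i.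
have ling (i : 'I_6) : scalar (g i).
  by case: i => [[|[|[|[|[|[|i]]]]]] lt] //= a u v; rewrite /g /= (alt_linear3 altT).
have gind (c : 'I_6 -> R) : (forall w, \sum_i c i * g i w = 0) -> forall i, c i = 0.
  move=> h; have {h} h w : \sum_(i < 6) c (inord i) * g i w = 0.
    by rewrite -[RHS](h w); apply: eq_bigr => i _; rewrite inord_val.
  have {}h w : c (inord 0) * T y z w + c (inord 1) * T z x w +
      c (inord 2) * T x y w + c (inord 3) * T x n0 w +
      c (inord 4) * T y n0 w + c (inord 5) * T z n0 w = 0.
    by rewrite -[RHS](h w) !big_ord_recr big_ord0 /= add0r.
  have cyc u v w : T v w u = T u v w by rewrite (altC23 altT) (altC12 altT) opprK.
  have mu_inj r : r * T x y z = 0 -> r = 0.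
    by move/eqP; rewrite mulf_eq0 (negbTE mu0) orbF => /eqP.
  have yzx : T y z x = T x y z by rewrite cyc.
  have zxy : T z x y = T x y z by rewrite -(cyc z x y).
  have z00 u v : T u v n0 = 0 -> T u n0 v = 0 /\ T v n0 u = 0.
    by move=> e; split; [rewrite (altC23 altT) | rewrite cyc]; rewrite ?e ?oppr0.
  have [xy xy'] := z00 _ _ xy0; have [yz yz'] := z00 _ _ yz0.
  have [zx zx'] := z00 _ _ zx0.
  have c0 : c (inord 0) = 0.
    by apply: mu_inj; have := h x; rewrite !diag yzx xy' zx; lra.
  have c1 : c (inord 1) = 0.
    by apply: mu_inj; have := h y; rewrite !diag zxy xy yz'; lra.
  have c2 : c (inord 2) = 0.
    by apply: mu_inj; have := h z; rewrite !diag yz zx'; lra.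
  pose u := c (inord 3) *: x + c (inord 4) *: y + c (inord 5) *: z.
  have [k uk] : exists k, u = k *: n0.
    apply: (ndT n00) => w; rewrite (altC12 altT) /u !(altD1 altT) !(altZ1 altT).
    by have := h w; rewrite c0 c1 c2; lra.
  have c3 : c (inord 3) = 0.
    have := congr1 (fun u => T u y z) uk; rewrite /u /= !(altD1 altT) !(altZ1 altT).
    by rewrite -(cyc n0 y z) yz0 !diag => ?; apply: mu_inj; lra.
  have c4 : c (inord 4) = 0.
    have := congr1 (fun u => T u z x) uk; rewrite /u /= !(altD1 altT) !(altZ1 altT).
    by rewrite -(cyc n0 z x) zx0 yzx !diag => ?; apply: mu_inj; lra.
  have c5 : c (inord 5) = 0.
    have := congr1 (fun u => T u x y) uk; rewrite /u /= !(altD1 altT) !(altZ1 altT).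
    by rewrite -(cyc n0 x y) xy0 zxy !diag => ?; apply: mu_inj; lra.
  move=> l; rewrite -[l]inord_val; case: l => [[|[|[|[|[|[|i]]]]]] lt] //=.
have solve := independent_functionals ling gind.
have sol (j : nat) : exists w, [/\ T y z w = 0, T z x w = 0, T x y w = 0 &
   [/\ T x n0 w = (j == 3%N)%:R, T y n0 w = (j == 4%N)%:R & T z n0 w = (j == 5%N)%:R]].
  have [w gw] := solve (fun i => if (i < 3)%N then 0 else (j == i :> nat)%:R).
  exists w; do !split.
  - exact: gw (@Ordinal 6 0 isT).
  - exact: gw (@Ordinal 6 1 isT).
  - exact: gw (@Ordinal 6 2 isT).
  - exact: gw (@Ordinal 6 3 isT).
  - exact: gw (@Ordinal 6 4 isT).
  - exact: gw (@Ordinal 6 5 isT).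
have [n1 [? ? ? [? ? ?]]] := sol 3%N; have [n2 [? ? ? [? ? ?]]] := sol 4%N.
have [n3 [? ? ? [? ? ?]]] := sol 5%N.
exists n0, n1, n2, n3; do 13!eexists.
by split.
Qed.

Ltac reframe F := rewrite ?(frame_model altT F) /model /det3 /=.

(** Twice the symmetric part of the matrix [m] is the Gram matrix of the three 2-forms on N under
    the wedge pairing. The skew part depends only on the choice of [n1], [n2], [n3] modulo [n0], and
    three multiples of [n0] remove its three entries. *)
Lemma frame_symmetrize x y z n0 n1 n2 n3
    mu m11 m12 m13 m21 m22 m23 m31 m32 m33 t0 t1 t2 t3 :
  frame T x y z n0 n1 n2 n3 mu m11 m12 m13 m21 m22 m23 m31 m32 m33 t0 t1 t2 t3 ->
  exists x y z n0 n1 n2 n3 s12 s13 s23 p1 p2 p3,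
  frame T x y z n0 n1 n2 n3 mu m11 s12 s13 s12 m22 s23 s13 s23 m33
    (t0 + t1 * p1 + t2 * p2 + t3 * p3) t1 t2 t3.
Proof.
move=> F; pose v := vec x y z n0 n1 n2 n3.
exists (v [:: 1]), (v [:: 0; 1]), (v [:: 0; 0; 1]), (v [:: 0; 0; 0; 1]),
  (v [:: 0; 0; 0; (m32 - m23) / 2; 1]), (v [:: 0; 0; 0; (m13 - m31) / 2; 0; 1]),
  (v [:: 0; 0; 0; (m21 - m12) / 2; 0; 0; 1]).
exists ((m12 + m21) / 2), ((m13 + m31) / 2), ((m23 + m32) / 2).
exists ((m32 - m23) / 2), ((m13 - m31) / 2), ((m21 - m12) / 2).
split; reframe F; first exact: f_mu F.
all: by field.
Qed.

(** Gaussian elimination by congruence with pivot [m11]: multiples of [x] are added to [y] and [z],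
    and [n1] undergoes the dual change, which preserves the values of [T] on [x, y, z] against [n0]
    and the [ni]. *)
Lemma frame_eliminate1 x y z n0 n1 n2 n3 mu m11 s12 s13 m22 s23 m33 t0 t1 t2 t3 :
  frame T x y z n0 n1 n2 n3 mu m11 s12 s13 s12 m22 s23 s13 s23 m33 t0 t1 t2 t3 ->
  m11 != 0 -> exists x y z n0 n1 n2 n3 m22 s23 m33 p q,
  frame T x y z n0 n1 n2 n3 mu m11 0 0 0 m22 s23 0 s23 m33
    t0 t1 (t2 + p * t1) (t3 + q * t1).
Proof.
move=> F m0; pose v := vec x y z n0 n1 n2 n3.
pose p := - s12 / m11; pose q := - s13 / m11.
exists (v [:: 1]), (v [:: p; 1]), (v [:: q; 0; 1]), (v [:: 0; 0; 0; 1]),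
  (v [:: 0; 0; 0; 0; 1; - p; - q]), (v [:: 0; 0; 0; 0; 0; 1]),
  (v [:: 0; 0; 0; 0; 0; 0; 1]).
exists (m22 - s12 ^+ 2 / m11), (s23 - s12 * s13 / m11), (m33 - s13 ^+ 2 / m11), p, q.
split; reframe F; rewrite /p /q; first exact: f_mu F.
all: by field.
Qed.

Lemma frame_eliminate2 x y z n0 n1 n2 n3 mu m11 m22 s23 m33 t0 t1 t2 t3 :
  frame T x y z n0 n1 n2 n3 mu m11 0 0 0 m22 s23 0 s23 m33 t0 t1 t2 t3 ->
  m22 != 0 -> exists x y z n0 n1 n2 n3 m33 r,
  frame T x y z n0 n1 n2 n3 mu m11 0 0 0 m22 0 0 0 m33 t0 t1 t2 (t3 + r * t2).
Proof.
move=> F m0; pose v := vec x y z n0 n1 n2 n3; pose r := - s23 / m22.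
exists (v [:: 1]), (v [:: 0; 1]), (v [:: 0; r; 1]), (v [:: 0; 0; 0; 1]),
  (v [:: 0; 0; 0; 0; 1]), (v [:: 0; 0; 0; 0; 0; 1; - r]),
  (v [:: 0; 0; 0; 0; 0; 0; 1]).
exists (m33 - s23 ^+ 2 / m22), r.
split; reframe F; rewrite /r; first exact: f_mu F.
all: by field.
Qed.

(** Contradiction from two vectors with [T(a, b, .) = 0] that are not proportional: [a] has entry 1
    at [i] and 0 at [j], while [b] has entry 1 at [j]. *)
Ltac isotropic F a b i j :=
  have [||k] := frame_kernel altT ndT dimW F (a := a) (b := b) (i := i) isT;
  [by rewrite /= oner_eq0 | by move=> c; rewrite /model /det3 /=; ring
  | by move=> /(_ j isT) /= /eqP; rewrite mulr0 oner_eq0].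

(* Pf (T(x, ., .)) = m11 vanishes only if T(x, v, .) = 0 for an explicit v
   independent of x. *)
Lemma frame_diagonalize x y z n0 n1 n2 n3
    mu m11 m12 m13 m21 m22 m23 m31 m32 m33 t0 t1 t2 t3 :
  frame T x y z n0 n1 n2 n3 mu m11 m12 m13 m21 m22 m23 m31 m32 m33 t0 t1 t2 t3 ->
  exists x y z n0 n1 n2 n3 m1 m2 m3 t0' t1' t2' t3',
  [/\ frame T x y z n0 n1 n2 n3 mu m1 0 0 0 m2 0 0 0 m3 t0' t1' t2' t3',
     [/\ m1 != 0, m2 != 0 & m3 != 0] &
     t0 = 0 -> t1 = 0 -> t2 = 0 -> t3 = 0 ->
     [/\ t0' = 0, t1' = 0, t2' = 0 & t3' = 0]].
Proof.
move=> /frame_symmetrize[{}x [{}y [{}z [{}n0 [{}n1 [{}n2 [{}n3]]]]]]].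
case=> [s12 [s13 [s23 [p1 [p2 [p3 F]]]]]].
have m110 : m11 != 0.
  apply/negP=> /eqP m0; rewrite m0 in F.
  isotropic F [:: 1 : R] [:: 0; 0; 0; s13; 0; 1] 0%N 5%N.
move: (frame_eliminate1 F m110).
case=> [{}x [{}y [{}z [{}n0 [{}n1 [{}n2 [{}n3 [{}m22 [{}s23 [{}m33 [p [q {}F]]]]]]]]]]]].
have m220 : m22 != 0.
  apply/negP=> /eqP m0; rewrite m0 in F.
  isotropic F [:: 0 : R; 1] [:: 0; 0; 0; 0; 0; 0; 1 : R] 1%N 6%N.
move: (frame_eliminate2 F m220).
case=> [{}x [{}y [{}z [{}n0 [{}n1 [{}n2 [{}n3 [{}m33 [r {}F]]]]]]]]].
have m330 : m33 != 0.
  apply/negP=> /eqP m0; rewrite m0 in F.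
  isotropic F [:: 0 : R; 0; 1] [:: 0; 0; 0; 0; 1 : R] 2%N 4%N.
exists x, y, z, n0, n1, n2, n3, m11, m22, m33; do 4!eexists.
split; [exact: F | by [] | move=> -> -> -> ->].
by split; ring.
Qed.

(* Replace z by z + n with n in N. The complement {u | T(x,y,u) = T(y,z',u) =
   T(z',x,u) = 0} is the graph of a map N -> <x, y>, and since the restrictions
   s1, s2 of T(x, ., .), T(y, ., .) to N satisfy s1 /\ s2 = 0, the restriction of
   T to it is t + (2/mu) (i_n s1) /\ s2: it is killed by solving a linear
   equation for n. *)
Lemma frame_isotropic_complement x y z n0 n1 n2 n3 mu m1 m2 m3 t0 t1 t2 t3 :
  frame T x y z n0 n1 n2 n3 mu m1 0 0 0 m2 0 0 0 m3 t0 t1 t2 t3 ->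
  m1 != 0 -> m2 != 0 -> exists x' y' z',
  T x' y' z' != 0 /\
  let N u := [/\ T x' y' u = 0, T y' z' u = 0 & T z' x' u = 0] in
  forall u v w, N u -> N v -> N w -> T u v w = 0.
Proof.
move=> F m10 m20; pose v := vec x y z n0 n1 n2 n3; have mu0 := f_mu F.
(* The components of the vector [n] added to [z]: a 3-form on the 4-dimensional N has four
   coefficients, and each of [t3], [t2], [t1], [t0] determines one component. *)
have [c0 c0E] : exists c, c = mu * t3 / 2 by eexists.
have [c1 c1E] : exists c, c = mu * t2 / (2 * m2) by eexists.
have [c2 c2E] : exists c, c = - (mu * t1) / (2 * m1) by eexists.
have [c3 c3E] : exists c, c = mu * t0 / (2 * m1 * m2) by eexists.
exists (v [:: 1]), (v [:: 0; 1]), (v [:: 0; 0; 1; c0; c1; c2; c3]); split.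
  by reframe F; rewrite (_ : _ + _ = mu) //; ring.
move=> N u1 u2 u3.
have coord u : N u -> exists a3 a4 a5 a6,
    u = v [:: - (c0 * a5 - c2 * a3 + m2 * (c3 * a4 - c1 * a6)) / mu;
     (c0 * a4 - c1 * a3 + m1 * (c2 * a6 - c3 * a5)) / mu; 0; a3; a4; a5; a6].
  have [a _ ->] := frame_span altT dimW F u.
  case; reframe F => h2 h0 h1; exists a`_3, a`_4, a`_5, a`_6; rewrite /v /vec /=.
  have e2 : a`_2 = 0 by apply: (mulfI mu0); rewrite mulr0 -[RHS]h2; ring.
  have e0 : a`_0 = - (c0 * a`_5 - c2 * a`_3 + m2 * (c3 * a`_4 - c1 * a`_6)) / mu.
    by apply: (mulIf mu0); rewrite divfK //; lra.
  have e1 : a`_1 = (c0 * a`_4 - c1 * a`_3 + m1 * (c2 * a`_6 - c3 * a`_5)) / mu.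
    by apply: (mulIf mu0); rewrite divfK //; lra.
  by rewrite {1}e0 {1}e1 {1}e2.
case/coord=> [a3 [a4 [a5 [a6 ->]]]] /coord[b3 [b4 [b5 [b6 ->]]]].
case/coord=> [d3 [d4 [d5 [d6 ->]]]].
reframe F; rewrite c0E c1E c2E c3E; field.
by rewrite ?mu0 ?m10 ?m20 ?andbT.
Qed.

Lemma frame_reduced : exists x y z n0 n1 n2 n3 mu m1 m2 m3,
  frame T x y z n0 n1 n2 n3 mu m1 0 0 0 m2 0 0 0 m3 0 0 0 0 /\
  [/\ m1 != 0, m2 != 0 & m3 != 0].
Proof.
have [x x0] : exists x : W, x != 0.
  exists (vpick {:W}); rewrite vpick0 -dimv_eq0 dimW //.
have [y yx] : exists y, y \notin <[x]>%VS.
  have /subvPn[y _ yx] : ~~ (fullv <= <[x]>)%VS.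
    by apply/negP=> /dimvS; rewrite dim_vline dimW; case: (x != 0).
  by exists y.
have [z T0] : exists z, T x y z != 0.
  apply: contrapT => h; case/negP: yx; apply/vlineP; apply: ndT => // z.
  by apply/eqP/negP=> /negP Tz; apply: h; exists z.
have := frame_exists T0; do 17!case=> ?.
case/frame_diagonalize=> [x1 [y1 [z1 [n0 [n1 [n2 [n3]]]]]]].
case=> [m1 [m2 [m3 [t0 [t1 [t2 [t3 [F [m10 m20 _] _]]]]]]]].
have [x2 [y2 [z2 [T2 iso]]]] := frame_isotropic_complement F m10 m20.
case: (frame_exists T2) => {F t0 t1 t2 t3 n0 n1 n2 n3 m1 m2 m3 m10 m20}.
move=> n0 [n1 [n2 [n3 [a1 [a2 [a3 [a4]]]]]]].
case=> [a5 [a6 [a7 [a8 [a9 [t0 [t1 [t2 [t3 F]]]]]]]]].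
(* The vectors [n0], ..., [n3] of a frame over the new triple lie in the complement on which [T]
   vanishes. The second diagonalization keeps these zeros. *)
have t00 : t0 = 0 by rewrite -(f_123 F); apply: iso; split; case: F.
have t10 : t1 = 0 by rewrite -(f_023 F); apply: iso; split; case: F.
have t20 : t2 = 0 by rewrite -(f_031 F); apply: iso; split; case: F.
have t30 : t3 = 0 by rewrite -(f_012 F); apply: iso; split; case: F.
case: (frame_diagonalize F) => {F}x' [y' [z' [n0' [n1' [n2' [n3' [m1 [m2 [m3]]]]]]]]].
case=> [s0 [s1 [s2 [s3 [F [? ? ?] /(_ t00 t10 t20 t30)[s00 s10 s20 s30]]]]]].
rewrite s00 s10 s20 s30 in F.
by do 11 eexists; split; first exact: F.
Qed.

(* Each wrong sign produces independent v, w with T(v, w, .) = 0; mu m1 > 0 is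
   the split octonion form. *)
Lemma frame_signs x y z n0 n1 n2 n3 mu m1 m2 m3 :
  frame T x y z n0 n1 n2 n3 mu m1 0 0 0 m2 0 0 0 m3 0 0 0 0 ->
  m1 != 0 -> m2 != 0 -> m3 != 0 -> [/\ 0 < m1 * m2, 0 < m1 * m3 & mu * m1 < 0].
Proof.
move=> F m10 m20 m30; have mu0 := f_mu F.
have root (r : R) : 0 < r -> exists2 s, s ^+ 2 = r & s != 0.
  move=> r0; exists (Num.sqrt r); first by rewrite sqr_sqrtr ?ltW.
  by rewrite gt_eqF ?sqrtr_gt0.
split.
- rewrite ltNge le_eqVlt mulf_eq0 (negbTE m10) (negbTE m20) /=; apply/negP=> lt.
  have [s s2 s0] : exists2 s, s ^+ 2 = - (m1 / m2) & s != 0.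
    apply: root; rewrite oppr_gt0 -(pmulr_llt0 _ (_ : 0 < m2 ^+ 2)).
      by rewrite expr2 mulrA divfK.
    by rewrite lt_def sqrf_eq0 m20 sqr_ge0.
  have e1 : m1 = - (s ^+ 2 * m2) by rewrite s2 mulNr opprK divfK.
  rewrite e1 in F.
  isotropic F [:: 1; s] [:: 0; 0; 0; 0; - s; 1] 0%N 5%N.
- rewrite ltNge le_eqVlt mulf_eq0 (negbTE m10) (negbTE m30) /=; apply/negP=> lt.
  have [s s2 s0] : exists2 s, s ^+ 2 = - (m1 / m3) & s != 0.
    apply: root; rewrite oppr_gt0 -(pmulr_llt0 _ (_ : 0 < m3 ^+ 2)).
      by rewrite expr2 mulrA divfK.
    by rewrite lt_def sqrf_eq0 m30 sqr_ge0.
  have e1 : m1 = - (s ^+ 2 * m3) by rewrite s2 mulNr opprK divfK.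
  rewrite e1 in F.
  isotropic F [:: 1; 0; s] [:: 0; 0; 0; 0; - s; 0; 1] 0%N 6%N.
- rewrite ltNge le_eqVlt eq_sym mulf_eq0 (negbTE m10) (negbTE mu0) /=; apply/negP=> lt.
  have [s s2 s0] := root _ lt.
  have e1 : m1 = s ^+ 2 / mu by rewrite s2 mulrAC divff // mul1r.
  rewrite e1 in F.
  (* With [s^2 = mu m1], the vectors [x + s n0] and [y - (mu / s) n3] contract [T] to zero. *)
  have [||k] := frame_kernel altT ndT dimW F (a := [:: 1; 0; 0; s])
    (b := [:: 0; 1; 0; 0; 0; 0; - (mu / s)]) (i := 0%N) isT.
  + by rewrite /= oner_eq0.
  + by move=> c; rewrite /model /det3 /=; field; rewrite ?mu0 ?s0.
  + by move=> /(_ 1%N isT) /= /eqP; rewrite mulr0 oner_eq0.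
Qed.

End NormalForm.

(** * Scaling to a single canonical 3-form *)

Section CanonicalForm.
Variable R : realType.

Lemma cube_root (q : R) : 0 < q -> exists2 t, t ^+ 3 = q & t != 0.
Proof.
move=> q0; pose p : {poly R} := 'X^3 - q%:P.
have pE u : p.[u] = u ^+ 3 - q by rewrite /p !hornerE.
have le : 0 <= 1 + q by lra.
(* The bound [1 + q] works because its cube is at least [1 + q], hence above [q]. *)
have [||t _ /rootP] := @poly_ivt _ p 0 (1 + q) => //.
  by rewrite !pE expr0n /=; apply/andP; split; nra.
rewrite pE => /subr0_eq tq; exists t => //.
by apply: contraTneq q0 => t0; rewrite -tq t0 expr0n ltxx.
Qed.

(** Scaling [x], [y], [z], [n0] by [a], [b], [c], [t] forces the factors [1/(at)], [1/(bt)],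
    [1/(ct)] on [n1], [n2], [n3], so that [T(x, n0, n1) = 1] and its analogues persist. The four
    equations say that [mu, m1, m2, m3] become [-1, 1, 1, 1]; the sign conditions supply the real
    square roots. *)
Lemma scaling_factors (mu m1 m2 m3 : R) :
  0 < m1 * m2 -> 0 < m1 * m3 -> mu * m1 < 0 -> exists a b c t,
  [/\ a != 0, b != 0, c != 0 & t != 0] /\
  [/\ a * b * c * mu = -1, a * m1 = b * c * t ^+ 2, b * m2 = a * c * t ^+ 2 &
      c * m3 = a * b * t ^+ 2].
Proof.
move=> h12 h13 hm.
have m10 : m1 != 0 by apply: contraTneq h12 => ->; rewrite mul0r ltxx.
pose e := Num.sg m1; have e2 : e * e = 1 by rewrite -expr2 sqr_sg m10.
have em : 0 < e * m1 by rewrite -normrEsg normr_gt0.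
have sq m : 0 < e * m -> exists2 s, m = e * s ^+ 2 & s != 0.
  move=> h; exists (Num.sqrt (e * m)); last by rewrite gt_eqF ?sqrtr_gt0.
  by rewrite sqr_sqrtr ?ltW // mulrA e2 mul1r.
have [s1 m1E s10] := sq m1 em.
have [s2 m2E s20] : exists2 s, m2 = e * s ^+ 2 & s != 0.
  apply: sq; rewrite -(pmulr_rgt0 _ em) mulrACA e2 mul1r //.
have [s3 m3E s30] : exists2 s, m3 = e * s ^+ 2 & s != 0.
  apply: sq; rewrite -(pmulr_rgt0 _ em) mulrACA e2 mul1r //.
have mu0 : mu != 0 by apply: contraTneq hm => ->; rewrite mul0r ltxx.
have [r muE r0] : exists2 s, - mu = e * s ^+ 2 & s != 0.
  by apply: sq; rewrite -(pmulr_rgt0 _ em) mulrACA e2 mul1r; lra.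
have {}muE : mu = - (e * r ^+ 2) by rewrite -muE opprK.
have [t t3 t0] : exists2 t, t ^+ 3 = `|s1 * s2 * s3 * r| & t != 0.
  by apply: cube_root; rewrite normr_gt0 !mulf_neq0.
have [f f2 fE] : exists2 f, f * f = 1 & `|s1 * s2 * s3 * r| = f * (s1 * s2 * s3 * r).
  exists (Num.sg (s1 * s2 * s3 * r)); last by rewrite normrEsg.
  by rewrite -expr2 sqr_sg !mulf_neq0.
have e0 : e != 0 by apply/eqP=> e0; move: e2; rewrite e0 mul0r => /eqP; rewrite eq_sym oner_eq0.
have f0 : f != 0 by apply/eqP=> f0; move: f2; rewrite f0 mul0r => /eqP; rewrite eq_sym oner_eq0.
(* With [mi = e si^2], [mu = - e r^2] and [e^2 = f^2 = 1], each of the four equations reduces to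
   [t^3 = f s1 s2 s3 r]. *)
exists (e * f * t / (s1 * r)), (e * f * t / (s2 * r)), (e * f * t / (s3 * r)), t.
split; first by split; rewrite ?mulf_neq0 ?invr_eq0 ?mulf_neq0.
have t3' : t ^+ 3 = f * (s1 * s2 * s3 * r) by rewrite t3.
have ee : e ^+ 2 = 1 by []. have ff : f ^+ 2 = 1 by [].
split.
- rewrite muE (_ : _ * _ = - (e ^+ 2) ^+ 2 * f ^+ 2 * f * t ^+ 3 / (s1 * s2 * s3 * r)).
    by rewrite t3' ee ff; field: f2; rewrite ?s10 ?s20 ?s30 ?r0.
  by field; rewrite ?s10 ?s20 ?s30 ?r0.
- rewrite m1E (_ : e * f * t / (s1 * r) * _ = e ^+ 2 * (f * t * s1 / r)).
    rewrite (_ : _ * t ^+ 2 = e ^+ 2 * f ^+ 2 * t * t ^+ 3 / (s2 * s3 * r ^+ 2)).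
      by rewrite t3' ee ff; field; rewrite ?s10 ?s20 ?s30 ?r0.
    by field; rewrite ?s10 ?s20 ?s30 ?r0.
  by field; rewrite ?s10 ?s20 ?s30 ?r0.
- rewrite m2E (_ : e * f * t / (s2 * r) * _ = e ^+ 2 * (f * t * s2 / r)).
    rewrite (_ : _ * t ^+ 2 = e ^+ 2 * f ^+ 2 * t * t ^+ 3 / (s1 * s3 * r ^+ 2)).
      by rewrite t3' ee ff; field; rewrite ?s10 ?s20 ?s30 ?r0.
    by field; rewrite ?s10 ?s20 ?s30 ?r0.
  by field; rewrite ?s10 ?s20 ?s30 ?r0.
- rewrite m3E (_ : e * f * t / (s3 * r) * _ = e ^+ 2 * (f * t * s3 / r)).
    rewrite (_ : _ * t ^+ 2 = e ^+ 2 * f ^+ 2 * t * t ^+ 3 / (s1 * s2 * r ^+ 2)).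
      by rewrite t3' ee ff; field; rewrite ?s10 ?s20 ?s30 ?r0.
    by field; rewrite ?s10 ?s20 ?s30 ?r0.
  by field; rewrite ?s10 ?s20 ?s30 ?r0.
Qed.

Lemma canonical_frame (W : vectType R) (T : W -> W -> W -> R) :
  alternating T -> nondegenerate T -> \dim {:W} = 7%N ->
  exists x y z n0 n1 n2 n3,
  frame T x y z n0 n1 n2 n3 (-1) 1 0 0 0 1 0 0 0 1 0 0 0 0.
Proof.
move=> altT ndT dimW.
case: (frame_reduced altT ndT dimW) => [x [y [z [n0 [n1 [n2 [n3]]]]]]].
case=> [mu [m1 [m2 [m3 [F [m10 m20 m30]]]]]].
have [h12 h13 hm] := frame_signs altT ndT dimW F m10 m20 m30.
have [a [b [c [t [[a0 b0 c0 t0] [emu e1 e2 e3]]]]]] := scaling_factors h12 h13 hm.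
pose v := vec x y z n0 n1 n2 n3.
exists (v [:: a]), (v [:: 0; b]), (v [:: 0; 0; c]), (v [:: 0; 0; 0; t]),
  (v [:: 0; 0; 0; 0; (a * t)^-1]), (v [:: 0; 0; 0; 0; 0; (b * t)^-1]),
  (v [:: 0; 0; 0; 0; 0; 0; (c * t)^-1]).
have e1' : m1 = b * c * t ^+ 2 / a by rewrite -e1 mulrAC divff ?mul1r.
have e2' : m2 = a * c * t ^+ 2 / b by rewrite -e2 mulrAC divff ?mul1r.
have e3' : m3 = a * b * t ^+ 2 / c by rewrite -e3 mulrAC divff ?mul1r.
have emu' : mu = - (a * b * c)^-1.
  apply: (@mulfI _ (a * b * c)); first by rewrite !mulf_neq0.
  by rewrite emu mulrN divff // !mulf_neq0.
split; rewrite ?(frame_model altT F) /model /det3 /=.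
  by rewrite oppr_eq0 oner_eq0.
all: rewrite ?e1' ?e2' ?e3' ?emu'; by field; rewrite ?a0 ?b0 ?c0 ?t0.
Qed.

Lemma vec_linear (W : vectType R) (x y z n0 n1 n2 n3 : W) k a b :
  vec x y z n0 n1 n2 n3 (mkseq (fun i => k * a`_i + b`_i) 7) =
  k *: vec x y z n0 n1 n2 n3 a + vec x y z n0 n1 n2 n3 b.
Proof. by rewrite /vec /=; veq f; ring. Qed.

Lemma vec_eq (W : vectType R) (x y z n0 n1 n2 n3 : W) (a b : seq R) :
  (forall i, (i < 7)%N -> a`_i = b`_i) ->
  vec x y z n0 n1 n2 n3 a = vec x y z n0 n1 n2 n3 b.
Proof. by move=> h; rewrite /vec !h. Qed.

Lemma vec_inj (W : vectType R) (T : W -> W -> W -> R) x y z n0 n1 n2 n3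
    mu m11 m12 m13 m21 m22 m23 m31 m32 m33 t0 t1 t2 t3 a b :
  alternating T ->
  frame T x y z n0 n1 n2 n3 mu m11 m12 m13 m21 m22 m23 m31 m32 m33 t0 t1 t2 t3 ->
  vec x y z n0 n1 n2 n3 a = vec x y z n0 n1 n2 n3 b ->
  forall i, (i < 7)%N -> a`_i = b`_i.
Proof.
move=> altT F e i i7; have := vec_linear x y z n0 n1 n2 n3 (-1) b a.
rewrite e scaleN1r addNr => /(frame_coordinates altT F)/(_ i i7).
by rewrite nth_mkseq // mulN1r addrC => /subr0_eq.
Qed.

Lemma alternating_forms_equivalent (W W' : vectType R)
    (T : W -> W -> W -> R) (T' : W' -> W' -> W' -> R) :
  alternating T -> nondegenerate T -> \dim {:W} = 7%N ->
  alternating T' -> nondegenerate T' -> \dim {:W'} = 7%N ->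
  exists f : 'Hom(W, W'), forall x y z, T' (f x) (f y) (f z) = T x y z.
Proof.
move=> altT ndT dimW altT' ndT' dimW'.
case: (canonical_frame altT ndT dimW) => [x [y [z [n0 [n1 [n2 [n3 F]]]]]]].
case: (canonical_frame altT' ndT' dimW') => [x' [y' [z' [n0' [n1' [n2' [n3' F']]]]]]].
(* Coordinates in the first frame are chosen vector by vector; their uniqueness, [vec_inj], makes
   the transfer to the second frame linear. *)
have /cid[a av] : exists a : W -> seq R,
    forall w, size (a w) = 7%N /\ w = vec x y z n0 n1 n2 n3 (a w).
  have h w : exists a, size a = 7%N /\ w = vec x y z n0 n1 n2 n3 a.
    by have [a] := frame_span altT dimW F w; exists a.
  by exists (fun w => sval (cid (h w))) => w; exact: svalP (cid (h w)).
have lin : linear (fun w => vec x' y' z' n0' n1' n2' n3' (a w)).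
  move=> k u w; rewrite -vec_linear; apply: vec_eq => i i7; rewrite nth_mkseq //.
  have -> : k * (a u)`_i + (a w)`_i = (mkseq (fun j => k * (a u)`_j + (a w)`_j) 7)`_i.
    by rewrite nth_mkseq.
  apply: (vec_inj altT F) i7; rewrite vec_linear.
  by have [_ <-] := av u; have [_ <-] := av w; have [_ <-] := av (k *: u + w).
have [f fE] := lfun_of_linear lin; exists f => u v w.
rewrite !fE (frame_model altT' F') -(frame_model altT F).
by have [_ <-] := av u; have [_ <-] := av v; have [_ <-] := av w.
Qed.

(** A nonzero [x] in the kernel has [T(x, y, .) = 0] for every [y], so every [y] would be a multiple
    of [x]. *)
Lemma nondegenerate_injective (W W' : vectType R)
    (T : W -> W -> W -> R) (T' : W' -> W' -> W' -> R) (f : 'Hom(W, W')) :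
  nondegenerate T -> (1 < \dim {:W})%N -> alternating T' ->
  (forall x y z, T' (f x) (f y) (f z) = T x y z) -> lker f == 0%VS.
Proof.
move=> nd dimW alt' fT; apply: lker0_of_eq0 => x fx; apply/eqP/negP=> /negP x0.
have yx y : exists c, y = c *: x.
  by apply: nd => // z; rewrite -fT fx (alt01 alt').
move: dimW; have -> : fullv = <[x]>%VS.
  apply/eqP; rewrite eq_sym eqEsubv subvf; apply/subvP=> y _.
  by apply/vlineP; exact: yx.
by rewrite dim_vline x0.
Qed.

End CanonicalForm.

(** * Stabilizer of a cross product *)

Section AlternatingProduct.
Variables (R : realType) (W : vectType R) (B : {symmetric W}).
Variable op : {bilinear W -> W -> W}.
Hypothesis Bneg : forall x, x != 0 -> B x x < 0.
Hypothesis alt : alternating (fun x y z => B (op x y) z).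

Lemma alternating_skew x y : op x y = - op y x.
Proof.
by apply: (form_separates Bneg) => z; rewrite formNl; exact: (altC12 alt).
Qed.

Lemma alternating_orthogonal1 x y : B (op x y) x = 0.
Proof. exact: (alt13 alt). Qed.

Lemma alternating_orthogonal2 x y : B (op x y) y = 0.
Proof. exact: (alt23 alt). Qed.

End AlternatingProduct.

Section CrossProduct.
Variables (R : realType) (W : vectType R) (B : {symmetric W}).
Variable op : {bilinear W -> W -> W}.
Hypothesis Bneg : forall x, x != 0 -> B x x < 0.
Hypothesis dimW : \dim {:W} = 7%N.
Hypothesis alt : alternating (fun x y z => B (op x y) z).
Hypothesis opK : forall x y, op x (op x y) = B x x *: y - B x y *: x.

Let formE := (formE B).

Lemma cross_eq0 x y : x != 0 -> op x y = 0 -> y = (B x y / B x x) *: x.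
Proof.
move=> x0 e; have := opK x y; rewrite e linear0r => /esym/subr0_eq h.
apply: (scalerI (negbT (lt_eqF (Bneg x0)))).
by rewrite h scalerA mulrC divfK // lt_eqF ?Bneg.
Qed.

Lemma cross_nondegenerate : nondegenerate (fun x y z => B (op x y) z).
Proof.
move=> x y x0 h; exists (B x y / B x x); apply: cross_eq0 => //.
exact: form_nondegenerate h.
Qed.

Let crossC := alternating_skew Bneg alt.

(** Polarization of [opK] in its first argument; orthogonality removes all terms involving [B]. *)
Lemma cross_swap x y z : B x y = 0 -> B x z = 0 -> B y z = 0 ->
  op x (op y z) = - op y (op x z).
Proof.
move=> xy xz yz; have := opK (x + y) z.
rewrite !formE !bilinE !opK xz yz xy (formC B y x) xy => h.
by veq f; move: (congr1 f h); rewrite ?(scalarE f) /=; lra.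
Qed.

Section Stabilizer.
Variable h : 'End(W).
Hypothesis hT : forall x y z, B (op (h x) (h y)) (h z) = B (op x y) z.

Let B_nondeg y : (forall x, B x y = 0) -> y = 0.
Proof. by move=> e; apply: (form_eq0 Bneg). Qed.

Let ht := adjoint B h.
Let htP x y : B (h x) y = B x (ht y).
Proof. exact: adjointP. Qed.

Lemma stabilizer_lker0 : lker h == 0%VS.
Proof.
apply: (nondegenerate_injective cross_nondegenerate _ alt hT).
by rewrite dimW.
Qed.

Let h_eq0 x : h x = 0 -> x = 0.
Proof. by move=> hx; apply: (lker0P stabilizer_lker0); rewrite hx linear0. Qed.

Let P := (ht \o h)%VF.
Let PE x : P x = ht (h x). Proof. by rewrite comp_lfunE. Qed.

Let symP : form_symmetric B P.
Proof. by move=> x y; rewrite !PE -htP formC -htP formC. Qed.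

Let ht_cross x y : ht (op (h x) (h y)) = op x y.
Proof.
by apply: (form_separates Bneg) => z; rewrite formC -htP formC hT.
Qed.

Let eigenvalue_gt0 e p : e != 0 -> P e = p *: e -> 0 < p.
Proof.
move=> e0 Pe; have he0 : h e != 0 by apply: contra_neq e0 => /h_eq0.
have := Bneg he0; rewrite htP -PE Pe formE; have := Bneg e0; nra.
Qed.

(** Let [v] be the preimage of [op (h e) (h f)] under [h]. By [ht_cross] and [opK], [v] and
    [(p q) op e f] have the same product with [e] and with [f]; their difference is thus a multiple
    of both [e] and [f], which are orthogonal, and vanishes. Applying [P] to [v] gives [op e f]. *)
Let eigen_cross e f p q : e != 0 -> f != 0 -> B e f = 0 ->
  P e = p *: e -> P f = q *: f -> (p * q) *: P (op e f) = op e f.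
Proof.
move=> e0 f0 ef Pe Pf.
pose v := (h^-1)%VF (op (h e) (h f)).
have hv : h v = op (h e) (h f) by rewrite /v lker0_lfunVK // stabilizer_lker0.
have Bh x y : B (h x) (h y) = B x (P y) by rewrite htP PE.
have ev : op e v = (p * q) *: op e (op e f).
  rewrite -ht_cross hv !opK !Bh Pe Pf !formE ef !mulr0 !scale0r !subr0.
  by rewrite linearZ /= -PE Pf !scalerA; congr (_ *: _); ring.
have fv : op f v = (p * q) *: op f (op e f).
  rewrite -ht_cross hv (crossC (h e)) (crossC e) !linearNr /= !opK !Bh Pe Pf !formE.
  rewrite (formC B f e) ef !mulr0 !scale0r !subr0 linearN linearZ /= -PE Pe scalerN !scalerA.
  by congr (- (_ *: _)); ring.
have {ev}/(cross_eq0 e0) he : op e (v - (p * q) *: op e f) = 0.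
  by rewrite linearBr linearZr_LR ev subrr.
have {fv}/(cross_eq0 f0) hf : op f (v - (p * q) *: op e f) = 0.
  by rewrite linearBr linearZr_LR fv subrr.
have v0 : v - (p * q) *: op e f = 0.
  rewrite he; set a := _ / _ in he *; suff -> : a = 0 by rewrite scale0r.
  have := congr1 (B e) hf; rewrite {1}he !formE ef mulr0 => /eqP.
  by rewrite mulf_eq0 (lt_eqF (Bneg e0)) orbF => /eqP.
by rewrite -linearZ /= -(subr0_eq v0) PE hv ht_cross.
Qed.

Let cross_neq0 x y : x != 0 -> y != 0 -> B x y = 0 -> op x y != 0.
Proof.
move=> x0 y0 xy; apply: contra_neq y0 => /(cross_eq0 x0) ->.
by rewrite xy mul0r scale0r.
Qed.

Let eigen_cross' e f p q : e != 0 -> f != 0 -> B e f = 0 ->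
  P e = p *: e -> P f = q *: f -> P (op e f) = (p * q)^-1 *: op e f.
Proof.
move=> e0 f0 ef Pe Pf.
have pq0 : p * q != 0.
  by rewrite mulf_neq0 // gt_eqF // (eigenvalue_gt0 _ Pe, eigenvalue_gt0 _ Pf).
by apply: (scalerI pq0); rewrite scalerA divff // scale1r (eigen_cross e0 f0).
Qed.

(* For an eigenvector k orthogonal to e, f, e /\ f, the vector
   f /\ (e /\ k) = - e /\ (f /\ k) has eigenvalues both p r / q and q r / p. *)
Let eigenvalues_equal e f p q : e != 0 -> f != 0 -> B e f = 0 ->
  P e = p *: e -> P f = q *: f -> p = q.
Proof.
move=> e0 f0 ef Pe Pf; have Pg := eigen_cross' e0 f0 ef Pe Pf.
have p0 := eigenvalue_gt0 e0 Pe; have q0 := eigenvalue_gt0 f0 Pf.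
pose X (i : 'I_3) := nth 0 [:: e; f; op e f] i.
pose l (i : 'I_3) := [:: p; q; (p * q)^-1]`_i.
have [||k [r [Xk k0 Pk]]] := @eigenvector_orthogonal _ _ B Bneg P 3 X l symP.
- by rewrite dimW.
- by case=> [[|[|[|i]]] lt].
have ek : B e k = 0 := Xk (@Ordinal 3 0 isT).
have fk : B f k = 0 := Xk (@Ordinal 3 1 isT).
have gk : B (op e f) k = 0 := Xk (@Ordinal 3 2 isT).
have r0 := eigenvalue_gt0 k0 Pk.
have f_ek : B f (op e k) = 0 by rewrite formC; have := altC23 alt e f k; rewrite gk oppr0.
have e_fk : B e (op f k) = 0.
  rewrite formC; have := altC23 alt f e k; have := altC12 alt e f k.
  by rewrite gk oppr0 => ->; rewrite oppr0.
have h1 := eigen_cross f0 (cross_neq0 e0 k0 ek) f_ek Pf (eigen_cross' e0 k0 ek Pe Pk).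
have h2 := eigen_cross e0 (cross_neq0 f0 k0 fk) e_fk Pe (eigen_cross' f0 k0 fk Pf Pk).
have v0 := cross_neq0 f0 (cross_neq0 e0 k0 ek) f_ek.
rewrite (cross_swap ef ek fk) linearN scalerN in h2.
move: (op f (op e k)) h1 (oppr_inj h2) v0 => v {}h1 {}h2 v0.
have Pv0 : P v != 0 by apply: contra_neq v0 => Pv; rewrite -h1 Pv scaler0.
move/eqP: (etrans h2 (esym h1)); rewrite -subr_eq0 -scalerBl scaler_eq0 (negbTE Pv0) orbF subr_eq0.
move=> /eqP h3; have : p ^+ 2 = q ^+ 2.
  have -> : p ^+ 2 = p / (q * r) * (p * q * r) by field; rewrite !gt_eqF.
  by rewrite h3; field; rewrite !gt_eqF.
by move/eqP; rewrite eqf_sqr => /orP[/eqP //|/eqP]; lra.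
Qed.

(** Orthogonal eigenvectors [e], [f] of [P] share an eigenvalue [p], and so do [e] and [op e f],
    whose eigenvalue is [1/p^2]. Hence [p^3 = 1] and [p = 1], so the symmetric operator [P - 1] has
    no nonzero eigenvalue and vanishes. *)
Lemma stabilizer_isometry x y : B (h x) (h y) = B x y.
Proof.
suff P1 : P - \1%VF = 0.
  rewrite htP -PE; congr (B x _).
  have := congr1 (fun D : 'End(W) => D y) P1.
  by rewrite add_lfunE opp_lfunE id_lfunE zero_lfunE => /subr0_eq.
have DE u : (P - \1%VF) u = P u - u by rewrite add_lfunE opp_lfunE id_lfunE.
apply: (symmetric_eq0 Bneg) => [u v|e a e0].
  by rewrite !DE !formE symP.
rewrite DE => h0; have Pe : P e = (a + 1) *: e by rewrite scalerDl scale1r -h0 subrK.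
have [||f [q [/(_ ord0) ef f0 Pf]]] :=
  @eigenvector_orthogonal _ _ B Bneg P 1 (fun=> e) (fun=> a + 1) symP.
- by rewrite dimW.
- by [].
have Pg := eigen_cross' e0 f0 ef Pe Pf.
have pq := eigenvalues_equal e0 f0 ef Pe Pf.
have eg : B e (op e f) = 0 by rewrite formC (alternating_orthogonal1 alt).
have pg := eigenvalues_equal e0 (cross_neq0 e0 f0 ef) eg Pe Pg.
have p0 := eigenvalue_gt0 e0 Pe.
rewrite -pq in pg.
have p3 : (a + 1) ^+ 3 = 1 by rewrite exprSr expr2 {3}pg mulfV // mulf_neq0 // gt_eqF.
suff : a + 1 = 1 by lra.
by apply/eqP; rewrite -(pexpr_eq1 (n := 3)) ?p3 ?ltW.
Qed.

Lemma stabilizer_cross x y : h (op x y) = op (h x) (h y).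
Proof.
have inj := lker0_lfunVK stabilizer_lker0.
apply: (form_separates Bneg) => z; rewrite -[z]inj stabilizer_isometry.
by rewrite hT.
Qed.

End Stabilizer.
End CrossProduct.

(** * Quadratic algebras and isotopes *)

Section Isomorphisms.
Variable R : realType.

Lemma lfun_bijective (A B : vectType R) (f : 'Hom(A, B)) :
  lker f == 0%VS -> \dim {:A} = \dim {:B} -> bijective f.
Proof.
move=> kf dAB; have limf : limg f = fullv.
  by apply/eqP; rewrite eqEdim subvf -dAB limg_dim_eq ?leqnn // (eqP kf) capv0.
exists (f^-1)%VF; first exact: lker0_lfunK.
by move=> y; rewrite limg_lfunVK // limf memvf.
Qed.

Lemma bijective_lker0 (A B : vectType R) (f : 'Hom(A, B)) :
  bijective f -> lker f == 0%VS.
Proof. by move/bij_inj/lker0P. Qed.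

Lemma bijective_limg (A B : vectType R) (f : 'Hom(A, B)) :
  bijective f -> limg f = fullv.
Proof.
case=> g _ gK; apply/eqP; rewrite eqEsubv subvf; apply/subvP=> y _.
by rewrite -[y]gK memv_img ?memvf.
Qed.

Lemma bijective_dim (A B : vectType R) (f : 'Hom(A, B)) :
  bijective f -> \dim {:A} = \dim {:B}.
Proof.
move=> bf; rewrite -(bijective_limg bf) limg_dim_eq //.
by rewrite (eqP (bijective_lker0 bf)) capv0.
Qed.

Lemma isomorphic_sym (A B : vectType R) (mA : {bilinear A -> A -> A})
    (mB : {bilinear B -> B -> B}) : isomorphic mA mB -> isomorphic mB mA.
Proof.
case=> f [bf fM]; exists (f^-1)%VF.
have fK : cancel f (f^-1)%VF by apply/lker0_lfunK/bijective_lker0.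
have fVK : cancel (f^-1)%VF f.
  by move=> y; rewrite limg_lfunVK // bijective_limg ?memvf.
split; first by exists f.
by move=> x y; rewrite -{1}[x]fVK -{1}[y]fVK -fM fK.
Qed.

Lemma isomorphic_trans (A B C : vectType R) (mA : {bilinear A -> A -> A})
    (mB : {bilinear B -> B -> B}) (mC : {bilinear C -> C -> C}) :
  isomorphic mA mB -> isomorphic mB mC -> isomorphic mA mC.
Proof.
case=> f [bf fM] [g [bg gM]]; exists (g \o f)%VF; split.
  apply: (eq_bij (bij_comp bg bf)) => x; by rewrite comp_lfunE.
by move=> x y; rewrite !comp_lfunE fM gM.
Qed.

Lemma isomorphic_transport (A B : vectType R) (mA : {bilinear A -> A -> A})
    (mB : {bilinear B -> B -> B}) : isomorphic mA mB ->
  noncommutative_Jordan mB -> linear_division mB ->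
  [/\ noncommutative_Jordan mA, linear_division mA & \dim {:A} = \dim {:B}].
Proof.
case=> f [bf fM] ncj [[b b0] div]; have inj := bij_inj bf; have [g fK gK] := bf.
split; last exact: bijective_dim bf.
  move=> x y; have [h1 h2] := ncj (f x) (f y).
  by split; apply: inj; rewrite linear0; [rewrite -[RHS]h1 | rewrite -[RHS]h2];
    rewrite /associator linearB /= !fM.
have gM x y : g (mB x y) = mA (g x) (g y) by apply: inj; rewrite fM !gK.
split.
  exists (g b); apply: contra_neq b0 => gb; by rewrite -[b]gK gb linear0.
move=> x x0; have fx0 : f x != 0.
  by apply: contra_neq x0 => fx; apply: inj; rewrite fx linear0.
have [[l lK Kl] [r rK Kr]] := div _ fx0; split.
  exists (fun y => g (l (f y))) => y; apply: inj; first by rewrite gK fM lK.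
  by rewrite fM gK Kl.
exists (fun y => g (r (f y))) => y; apply: inj; first by rewrite gK fM rK.
by rewrite fM gK Kr.
Qed.

Lemma no_zero_divisors_division (A : vectType R) (m : {bilinear A -> A -> A}) :
  (exists x : A, x != 0) -> (forall x y, m x y = 0 -> x = 0 \/ y = 0) ->
  linear_division m.
Proof.
move=> A0 nzd; split=> // x x0.
have bij (f : A -> A) : linear f -> (forall y, f y = 0 -> y = 0) -> bijective f.
  move=> lin f0; have [F FE] := lfun_of_linear lin.
  apply: (eq_bij _ FE); apply: lfun_bijective => //.
  by apply: lker0_of_eq0 => y; rewrite FE; exact: f0.
split; apply: bij => [a u v|y].
- by rewrite linearPr.
- by case/nzd=> // x00; rewrite x00 eqxx in x0.
- by rewrite linearPl.
- by case/nzd=> // x00; rewrite x00 eqxx in x0.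
Qed.

End Isomorphisms.

(** In a quadratic algebra the square of [x] is a combination of [x] and the unit, so this reduces
    the Jordan identity to flexibility. *)
Lemma associator_affine (R : realType) (A : vectType R)
    (m : {bilinear A -> A -> A}) e k c x y z : (forall u, m e u = u) ->
  associator m (k *: x + c *: e) y z = k *: associator m x y z.
Proof.
move=> ml; rewrite /associator !linearPl !linearZl_LR !ml.
by rewrite opprD addrACA subrr addr0 -scalerBr.
Qed.

Section QuadraticAlgebra.
Variables (R : realType) (W : vectType R) (B : {symmetric W}).
Variable op : {bilinear W -> W -> W}.
Hypothesis Bneg : forall x, x != 0 -> B x x < 0.
Hypothesis alt : alternating (fun x y z => B (op x y) z).

Let skew := alternating_skew Bneg alt.
Let orth1 := alternating_orthogonal1 alt.
Let orth2 := alternating_orthogonal2 alt.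

Lemma quad_flexible p q : associator (quad_mul B op) p q p = 0.
Proof.
case: p q => a x [b y]; rewrite /associator /quad_mul /=; congr (_, _) => /=.
  rewrite !formE (formC B y x) (formC B x (op y x)).
  by rewrite orth1 orth2; ring.
rewrite (formC B y x) !bilinE (skew (op x y)) (skew y x).
by veq f; ring.
Qed.

Lemma quad_mul1l q : quad_mul B op (1, 0) q = q.
Proof.
by case: q => b y; rewrite /quad_mul /= form0l !linear0l scaler0 scale1r mul1r !addr0.
Qed.

Lemma quad_mul1r q : quad_mul B op q (1, 0) = q.
Proof.
case: q => b y; rewrite /quad_mul /= form0r !linear0r scaler0 scale1r mulr1.
by rewrite add0r !addr0.
Qed.

Lemma quad_mul_square a x : quad_mul B op (a, x) (a, x) =
  (2 * a) *: ((a, x) : (R^o * W)%type) + (B x x - a ^+ 2) *: ((1, 0) : (R^o * W)%type).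
Proof.
rewrite /quad_mul /= (_ : op x x = 0); last first.
  by have := skew x x => h; veq f; move: (congr1 f h); rewrite ?(scalarE f) /=; lra.
congr (_, _); first by rewrite /= /GRing.scale /=; ring.
by rewrite /=; veq f; ring.
Qed.

Lemma quad_noncommutative_Jordan : noncommutative_Jordan (quad_mul B op).
Proof.
move=> [a x] q; split; first exact: quad_flexible.
pose m : {bilinear _ -> _ -> _} := quad_mul B op.
apply: etrans (congr1 (fun u => associator m u q (a, x)) (quad_mul_square a x)) _.
apply: etrans (associator_affine _ _ _ _ _ quad_mul1l) _.
by rewrite quad_flexible scaler0.
Qed.

Lemma quad_dim : \dim {:(R^o * W)%type} = (\dim {:W}).+1.
Proof. by rewrite !dimvf. Qed.

Hypothesis nd : nondegenerate (fun x y z => B (op x y) z).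

(** Pairing the vector part of [(a + x)(b + y) = 0] with [op x y], which is orthogonal to [x] and
    [y], gives [op x y = 0], hence [y = c x] when [x] is not zero. Then [b = - a c] and
    [c (B x x - a^2) = 0], where the bracket is negative. *)
Lemma quad_linear_division : linear_division (quad_mul B op).
Proof.
apply: no_zero_divisors_division.
  by exists ((1, 0) : (R^o * W)%type); rewrite -pair_eqE /= oner_eq0.
move=> [a x] [b y] [e1 e2].
have [x0|x0] := eqVneq x 0.
  rewrite x0 in e1 e2 *; have [a0|a0] := eqVneq a 0; first by left; rewrite a0.
  right; move: e1 e2; rewrite form0l linear0l scaler0 !addr0.
  move=> /eqP; rewrite mulf_eq0 (negbTE a0) => /eqP ->.
  by move=> /eqP; rewrite scaler_eq0 (negbTE a0) => /eqP ->.
have xy0 : op x y = 0.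
  apply: (form_eq0 Bneg); have := congr1 (B (op x y)) e2.
  by rewrite !formE orth1 orth2 !mulr0 !add0r.
have [c yc] : exists c, y = c *: x by apply: nd => // z; rewrite xy0 form0l.
rewrite yc in e1 e2 *; move: e2.
have -> : op x (c *: x) = 0 by rewrite -yc.
rewrite addr0 scalerA -scalerDl => /eqP.
rewrite scaler_eq0 (negbTE x0) orbF addrC addr_eq0 => /eqP ba.
move: e1; rewrite ba formE => e1; have Bx := Bneg x0.
have {e1} : c * (B x x - a ^+ 2) = 0 by rewrite -e1; ring.
move/eqP; rewrite mulf_eq0 => /orP[/eqP ->|/eqP h].
  by right; rewrite mulr0 oppr0 scale0r.
by exfalso; have := sqr_ge0 (a : R); lra.
Qed.

End QuadraticAlgebra.

Section QuadraticIsomorphisms.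
Variables (R : realType) (W W' : vectType R).
Variables (B : {symmetric W}) (B' : {symmetric W'}).
Variables (op : {bilinear W -> W -> W}) (op' : {bilinear W' -> W' -> W'}).
Hypothesis Bneg : forall x, x != 0 -> B x x < 0.
Hypothesis Bneg' : forall x, x != 0 -> B' x x < 0.
Hypothesis alt : alternating (fun x y z => B (op x y) z).
Hypothesis alt' : alternating (fun x y z => B' (op' x y) z).

(** The unit is preserved, and imaginary vectors are recognized by their squares: if
    [F (0, x) = (a, w)], comparing squares gives [2 a w = 0], and [w = 0] leads to
    [a^2 = B x x <= 0]; so [a = 0] in both cases. *)
Lemma quad_isomorphism (F : 'Hom((R^o * W)%type, (R^o * W')%type)) :
  alg_iso (quad_mul B op) (quad_mul B' op') F ->
  exists g : 'Hom(W, W'), [/\ forall a x, F (a, x) = (a, g x),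
    forall x y, B' (g x) (g y) = B x y &
    forall x y, g (op x y) = op' (g x) (g y)].
Proof.
case=> [[G FK GK] FM'].
have FM x y : F (quad_mul B op x y) = quad_mul B' op' (F x) (F y) := FM' x y.
have F1 : F (1, 0) = (1, 0).
  by have := FM (1, 0) (G (1, 0)); rewrite quad_mul1l GK quad_mul1r.
have Fpair a x : F (a, x) = a *: F (1, 0) + F (0, x).
  rewrite -linearP; congr (F _); congr (_, _) => /=.
    by rewrite /GRing.scale /= mulr1 addr0.
  by rewrite scaler0 add0r.
have F0 x : (F (0, x)).1 = 0.
  have := FM (0, x) (0, x); rewrite (quad_mul_square Bneg alt).
  case E : (F (0, x)) => [a w]; rewrite (quad_mul_square Bneg' alt').
  rewrite mulr0 scale0r add0r expr0n subr0 linearZ /= F1 => -[e1 e2].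
  rewrite /GRing.scale /= !mulr1 in e1; rewrite !scaler0 addr0 in e2.
  have Bx : B x x <= 0 by exact: form_le0.
  move/eqP: e2; rewrite eq_sym scaler_eq0 mulf_eq0 pnatr_eq0 /= => /orP[/eqP //|/eqP w0].
  move: e1; rewrite w0 form0l => e1; apply/eqP; rewrite -sqrf_eq0; apply/eqP.
  by have := sqr_ge0 (a : R); lra.
have [g gE] : exists g : 'Hom(W, W'), g =1 (fun x => (F (0, x)).2).
  apply: lfun_of_linear => a x y.
  have -> : ((0, a *: x + y) : (R^o * W)%type) = a *: (0, x) + (0, y).
    by congr (_, _); rewrite /= scaler0 addr0.
  by rewrite linearP.
have FE a x : F (a, x) = (a, g x).
  rewrite Fpair F1 gE [F (0, x)]surjective_pairing F0; congr (_, _) => /=.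
    by rewrite /GRing.scale /= mulr1 addr0.
  by rewrite scaler0 add0r.
exists g; split=> // x y; have := FM (0, x) (0, y); rewrite !FE /quad_mul /=.
  by case=> + _; rewrite !mul0r !add0r.
by case=> _; rewrite !scale0r !add0r.
Qed.

Lemma quad_isomorphic (g : 'Hom(W, W')) : bijective g ->
  (forall x y, B' (g x) (g y) = B x y) ->
  (forall x y, g (op x y) = op' (g x) (g y)) ->
  exists F : 'Hom((R^o * W)%type, (R^o * W')%type),
    alg_iso (quad_mul B op) (quad_mul B' op') F /\ forall x, F x = (x.1, g x.2).
Proof.
move=> [k gK kK] isoB hom.
have lin : linear (fun x : (R^o * W)%type => (x.1, g x.2) : (R^o * W')%type).
  by move=> a x y; rewrite /= linearP.
have [F FE] := lfun_of_linear lin; exists F; split; last exact: FE.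
split.
  exists (fun x => (x.1, k x.2)) => [[a x]|[a x]]; first by rewrite FE /= gK.
  by rewrite FE /= kK.
move=> [a x] [b y]; apply: etrans (FE _) _; rewrite (FE (a, x)) (FE (b, y)).
by congr (_, _); rewrite /= ?isoB // !linearD !linearZ -hom.
Qed.

End QuadraticIsomorphisms.

Section Isotopes.
Variables (R : realType) (W : vectType R) (B : {symmetric W}).
Variable op : {bilinear W -> W -> W}.
Hypothesis Bneg : forall x, x != 0 -> B x x < 0.
Hypothesis alt : alternating (fun x y z => B (op x y) z).

Lemma form_adjoint (phi : 'End(W)) x y : B (phi x) y = B x (adjoint B phi y).
Proof. by apply: adjointP => z e; apply: (form_eq0 Bneg). Qed.

Lemma form_isotope (phi : 'End(W)) x y z :
  B (isotope B op phi x y) z = B (op (phi x) (phi y)) (phi z).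
Proof. by rewrite formC -form_adjoint formC. Qed.

Lemma isotope_alternating (phi : 'End(W)) : alternating (fun x y z => B (isotope B op phi x y) z).
Proof.
split=> *; rewrite ?form_isotope 1?linearP.
- exact: (alt_linear1 alt).
- exact: (alt_linear2 alt).
- exact: (alt_linear3 alt).
- exact: (alt12 alt).
- exact: (alt23 alt).
Qed.

Lemma isotope_nondegenerate (phi : 'End(W)) : nondegenerate (fun x y z => B (op x y) z) ->
  bijective phi -> nondegenerate (fun x y z => B (isotope B op phi x y) z).
Proof.
move=> nd [psi phiK psiK] x y x0 h.
have phix0 : phi x != 0 by apply: contra_neq x0 => e; apply: (can_inj phiK); rewrite e linear0.
have [c e] : exists c, phi y = c *: phi x.
  by apply: nd => // z; have := h (psi z); rewrite form_isotope psiK.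
by exists c; apply: (can_inj phiK); rewrite e linearZ.
Qed.

Lemma adjoint_symmetric s : form_symmetric B s -> adjoint B s = s.
Proof.
move=> sym; apply/lfunP=> y; apply: (form_separates Bneg) => x.
by rewrite formC -form_adjoint formC -sym.
Qed.

Lemma isotope_conjugate (s s' g : 'End(W)) :
  form_symmetric B s -> form_symmetric B s' ->
  (forall x, g (s' x) = s (g x)) -> (forall x y, g (op x y) = op (g x) (g y)) ->
  forall x y, g (isotope B op s' x y) = isotope B op s (g x) (g y).
Proof.
by move=> ss ss' gs gM x y; rewrite /isotope !adjoint_symmetric // gs gM !gs.
Qed.

End Isotopes.

(** * Classification of the division algebras *)

Section Octonions.
Variable R : realType.
Local Notation W := (ImO R).
Local Notation form := (@octform R).
Local Notation cross := (@wedge R).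

Lemma ImO_dim : \dim {:W} = 7%N.
Proof.
have -> : \dim {:W} = \dim (imO R) by rewrite dimvf.
have := limg_ker_dim (linfun (@oct_re R)) fullv.
rewrite capfv (_ : limg _ = fullv).
  by rewrite !dimvf addn1 => h; apply: succn_inj; exact: h.
apply/eqP; rewrite eqEsubv subvf; apply/subvP=> r _; apply/memv_imgP.
by exists ((((r, 0), 0), 0) : oct R); rewrite ?memvf // lfunE.
Qed.

Lemma ImO_coordinates (x : W) : exists b c d e f g h : R,
  vsval x = (((0, b), (c, d)), ((e, f), (g, h))).
Proof.
have: oct_re (vsval x) == 0 by rewrite -imOP subvsP.
case: (vsval x) => [[[a b] [c d]] [[e f] [g h]]] /eqP a0.
by have {}a0 : a = 0 := a0; rewrite a0; exists b, c, d, e, f, g, h.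
Qed.

Lemma oct_triple_zero (x z : W) : form (cross x z) z = 0.
Proof.
rewrite /octform wedgeE.
have [b [c [d [e [f [g [h ->]]]]]]] := ImO_coordinates x.
have [b' [c' [d' [e' [f' [g' [h' ->]]]]]]] := ImO_coordinates z.
by rewrite /oct_im /oct_re /= /real_mul /GRing.scale /=; ring.
Qed.

(** The vector part of the left alternative law [x (x y) = x^2 y] for imaginary octonions, verified
    in coordinates. *)
Lemma oct_cross_cross (x y : W) :
  cross x (cross x y) = form x x *: y - form x y *: x.
Proof.
apply: subvs_inj; rewrite wedgeE wedgeE /octform.
have -> : vsval (oct_re (@oct_mul R (vsval x) (vsval x)) *: y -
    oct_re (@oct_mul R (vsval x) (vsval y)) *: x) =
  oct_re (@oct_mul R (vsval x) (vsval x)) *: vsval y -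
    oct_re (@oct_mul R (vsval x) (vsval y)) *: vsval x by [].
have [b [c [d [e [f [g [h ->]]]]]]] := ImO_coordinates x.
have [b' [c' [d' [e' [f' [g' [h' ->]]]]]]] := ImO_coordinates y.
rewrite /oct_im /oct_re.
by do !congr (_, _); rewrite /= /real_mul /GRing.scale /=; ring.
Qed.

Lemma oct_alternating : alternating (fun x y z => form (cross x y) z).
Proof.
split=> [a x x' y z|a x x' y z|a x x' y z|x z|x z].
- by rewrite linearPl formDl formZl.
- by rewrite linearPr formDl formZl.
- by rewrite formDr formZr.
- have h := wedge_anticomm x x; have -> : cross x x = 0.
    by veq f; move: (congr1 f h); rewrite ?(scalarE f) /=; lra.
  by rewrite form0l.
- exact: oct_triple_zero.
Qed.

Lemma oct_nondegenerate : nondegenerate (fun x y z => form (cross x y) z).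
Proof. exact: (cross_nondegenerate (@octform_def R) oct_cross_cross). Qed.

End Octonions.

Section ImaginarySpace.
Variables (R : realType) (A : vectType R) (mul : {bilinear A -> A -> A}).
Hypotheses (ncj : noncommutative_Jordan mul) (lda : linear_division mul).
Hypothesis dimA : \dim {:A} = 8%N.
Variable one : A.
Hypotheses (one0 : one != 0) (oneP : forall x, mul one x = x /\ mul x one = x).
Local Notation re := (re ncj lda one0 oneP).
Local Notation "x ** y" := (mul x y) (at level 40, left associativity).

Definition imaginary : {vspace A} := lker (linfun re).

Lemma imaginaryP x : (x \in imaginary) = (re x == 0).
Proof. by rewrite memv_ker lfunE. Qed.

Lemma imaginary_dim : \dim imaginary = 7%N.
Proof.
have := limg_ker_dim (linfun re) fullv.
rewrite capfv dimA (_ : limg _ = fullv).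
  by rewrite dimvf addn1 => -[].
apply/eqP; rewrite eqEsubv subvf; apply/subvP=> r _; apply/memv_imgP.
by exists (r *: one); rewrite ?memvf // lfunE /= re_real.
Qed.

Definition imaginary_form (x y : subvs_of imaginary) : R := re (vsval x ** vsval y).

Lemma imaginary_form_is_bilinear :
  bilinear_for (GRing.Scale.Law.clone _ _ *%R _)
    (GRing.Scale.Law.clone _ _ (idfun \; *%R) _) imaginary_form.
Proof.
have valP a (u v : subvs_of imaginary) : vsval (a *: u + v) = a *: vsval u + vsval v.
  exact: linearP.
have reP a x y : re (a *: x + y) = a * re x + re y by exact: linearP.
by split=> x a y z; rewrite /imaginary_form valP ?linearPl ?linearPr reP.
Qed.

HB.instance Definition _ :=
  bilinear_isBilinear.Build R (subvs_of imaginary) (subvs_of imaginary) R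
    _ _ imaginary_form imaginary_form_is_bilinear.

Lemma re_vsval (x : subvs_of imaginary) : re (vsval x) = 0.
Proof. by apply/eqP; rewrite -imaginaryP subvsP. Qed.

Lemma imaginary_form_sym x y :
  imaginary_form x y = (-1) ^+ false * idfun (imaginary_form y x).
Proof. by rewrite expr0 mul1r; apply: imag_comm; apply: re_vsval. Qed.

HB.instance Definition _ :=
  isHermitianSesquilinear.Build R (subvs_of imaginary) false idfun imaginary_form
    imaginary_form_sym.

Lemma imaginary_form_neg x : x != 0 -> imaginary_form x x < 0.
Proof.
by move=> x0; apply: imag_sq_lt0; [exact: re_vsval | rewrite (inj_eq val_inj x 0)].
Qed.

(** An isometry [i] first identifies the imaginary space of A with that of O, so that the quadratic
    forms agree and only the 3-forms differ; [phi] carries one 3-form to the other. As [phi] need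
    not preserve the quadratic form, the result is an isotope rather than O itself. *)
Lemma division_isotope : exists phi : 'End(ImO R),
  bijective phi /\ isomorphic mul (octonion_isotope phi).
Proof.
have [i iB] : exists i : 'Hom(ImO R, subvs_of imaginary),
    forall x y, imaginary_form (i x) (i y) = octform x y.
  apply: (euclidean_isometry (@octform_def R) imaginary_form_neg).
  by rewrite ImO_dim dimvf /dim /= imaginary_dim.
have i0 x : i x = 0 -> x = 0.
  move=> ix; apply: (form_eq0 (@octform_def R)).
  by apply: etrans (esym (iB x x)) _; rewrite ix /imaginary_form linear0r linear0.
have ki : lker i == 0%VS.
  exact: lker0_of_eq0.
have [k _ ik] : bijective i.
  by apply: lfun_bijective ki _; rewrite ImO_dim dimvf /dim /= imaginary_dim.
pose j x : A := vsval (i x).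
have jP a x y : j (a *: x + y) = a *: j x + j y by rewrite /j linearP.
have jre x : re (j x) = 0 by exact: re_vsval.
have jim w : re w = 0 -> exists x, w = j x.
  move=> rw; exists (k (vsproj imaginary w)).
  by rewrite /j ik vsprojK // imaginaryP rw.
have j0 x : j x = 0 -> x = 0.
  by move=> jx; apply: i0; apply: subvs_inj; rewrite -/(j x) jx.
have reP a x y : re (a *: x + y) = a * re x + re y by exact: linearP.
have jB x y : re (j x ** j y) = octform x y by exact: iB.
have re_one_mul r x : re ((r *: one) ** j x) = 0.
  by rewrite linearZl_LR (oneP _).1 linearZ /= jre scaler0.
pose T x y z := re ((j x ** j y) ** j z).
have altT : alternating T.
  split=> [a x x' y z|a x x' y z|a x x' y z|x z|x z]; rewrite /T.
  - by rewrite jP !linearPl reP.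
  - by rewrite jP linearPr linearPl reP.
  - by rewrite jP linearPr reP.
  - by rewrite (imag_sq (jre x)) re_one_mul.
  (* Modulo real multiples of the unit [x z = - z x], which turns [re ((x z) z)] into
     [- re ((z x) z)]; the latter is zero by flexibility. *)
  - have := imag_anticomm (jre x) (jre z) => h.
    have -> : j x ** j z = (re (j x ** j z) + re (j z ** j x)) *: one - j z ** j x.
      by rewrite -h addrK.
    by rewrite linearBl linearB /= re_one_mul (re_mul3_eq0 (jre z) (jre x)) subrr.
have ndT : nondegenerate T.
  move=> x y x0 h; have jx0 : j x != 0 by apply: contra_neq x0 => /j0.
  have [|c e] := triple_nondegenerate (jre x) (jre y) jx0.
    by move=> w /jim[z ->]; exact: h.
  exists c; apply/eqP; rewrite -subr_eq0; apply/eqP/j0.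
  by rewrite addrC -scaleNr jP e scaleNr addNr.
have [phi phiT] := alternating_forms_equivalent altT ndT (ImO_dim R)
  (@oct_alternating R) (@oct_nondegenerate R) (ImO_dim R).
have kphi : lker phi == 0%VS.
  by apply: (nondegenerate_injective ndT _ (@oct_alternating R) phiT); rewrite ImO_dim.
exists phi; split; first exact: lfun_bijective.
apply: isomorphic_sym.
(* The imaginary part of [j x ** j y] and the isotope product have the same inner product [T x y z]
   with every [z], so definiteness identifies them. *)
have jmul x y : j x ** j y = octform x y *: one + j (isotope (@octform R) (@wedge R) phi x y).
  have [|v ev] := jim (j x ** j y - re (j x ** j y) *: one).
    by rewrite linearB /= re_real subrr.
  rewrite -jB addrC; apply/eqP; rewrite -subr_eq; apply/eqP; rewrite ev; congr j.
  apply: (form_separates (@octform_def R)) => z.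
  apply/esym/(etrans (form_isotope _ (@octform_def R) phi x y z)).
  apply: etrans (phiT x y z) _; apply: etrans (jB v z).
  by rewrite -ev /T linearBl linearB /= re_one_mul subr0.
pose f (p : (R^o * ImO R)%type) : A := p.1 *: one + j p.2.
have linf : linear f.
  move=> a [b x] [c y]; rewrite /f /= jP; veq g; rewrite /GRing.scale /=; ring.
have [F FE] := lfun_of_linear linf; exists F; split.
  apply: lfun_bijective; last by rewrite quad_dim ImO_dim dimA.
  apply: lker0_of_eq0 => -[a x]; rewrite FE /f /= => h.
  have := congr1 re h; rewrite reP re_one jre linear0 mulr1 addr0 => a0.
  by move: h; rewrite a0 scale0r add0r => /j0 ->.
move=> [a x] [b y]; rewrite !FE.
apply: etrans (_ : f (quad_mul (@octform R)
  (isotope (@octform R) (@wedge R) phi) (a, x) (b, y)) = _); first by [].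
rewrite /f /quad_mul /=; move: (jmul x y); move: (isotope _ _ _ _ _) => w jm.
rewrite -[a *: y + b *: x + w]addrA jP -[b *: x + w]addr0 addr0 jP.
rewrite !linearDl !linearDr !linearZl_LR !linearZr_LR !(oneP _).1 !(oneP _).2 jm.
by veq g; ring.
Qed.

End ImaginarySpace.

Section PositiveIsotopes.
Variables (R : realType) (W : vectType R) (B : {symmetric W}).
Variable op : {bilinear W -> W -> W}.
Hypothesis Bneg : forall x, x != 0 -> B x x < 0.

Lemma isometry_lker0 (g : 'End(W)) :
  (forall x y, B (g x) (g y) = B x y) -> lker g == 0%VS.
Proof.
move=> gB; apply: lker0_of_eq0 => x gx.
by apply: (form_eq0 Bneg); rewrite -gB gx form0l.
Qed.

Lemma positive_lker0 (s : 'End(W)) :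
  (forall x, x != 0 -> 0 < - B (s x) x) -> lker s == 0%VS.
Proof.
move=> ps; apply: lker0_of_eq0 => x sx.
by apply/eqP/negP=> /negP/ps; rewrite sx form0l oppr0 ltxx.
Qed.

(* With phi phi^* = s^2 and s positive, u := s (phi^* )^-1 is orthogonal and
   phi = s u. *)
Lemma polar_isotope (phi : 'End(W)) : bijective phi ->
  exists s u : 'End(W), [/\ posdef_symmetric B s, bijective u,
    forall x y, B (u x) (u y) = B x y &
    forall x y, u (isotope B op phi x y) = isotope B op s (u x) (u y)].
Proof.
move=> bphi; pose P := (phi \o adjoint B phi)%VF.
have PE x : P x = phi (adjoint B phi x) by rewrite comp_lfunE.
have adj := form_adjoint Bneg phi.
have kadj : lker (adjoint B phi) == 0%VS.
  have [psi _ psiK] := bphi; apply: lker0_of_eq0 => x ax; apply: (form_eq0 Bneg).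
  by rewrite -{1}[x]psiK adj ax form0r.
have symP : form_symmetric B P.
  by move=> x y; rewrite !PE adj formC -adj formC.
have posP x : x != 0 -> 0 < - B (P x) x.
  move=> x0; rewrite PE adj oppr_gt0; apply: Bneg.
  by apply: contra_neq x0 => ax; apply: (lker0P kadj); rewrite ax linear0.
have [s [ss ps sP]] := positive_square_root Bneg symP posP.
have ks := positive_lker0 ps.
pose u := (s \o (adjoint B phi)^-1)%VF.
have uE a : u (adjoint B phi a) = s a by rewrite comp_lfunE lker0_lfunK.
have aK := lker0_lfunVK kadj.
have uB x y : B (u x) (u y) = B x y.
  rewrite -[x]aK -[y]aK !uE; move: ((_^-1)%VF x) ((_^-1)%VF y) => a b.
  by rewrite -ss sP PE adj.
have su x : s (u x) = phi x by rewrite -[x]aK uE sP PE.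
exists s, u; split=> //.
- by split=> //; apply: lfun_bijective.
- exact: lfun_bijective (isometry_lker0 uB) _.
- by move=> x y; rewrite /isotope uE !su adjoint_symmetric.
Qed.

End PositiveIsotopes.

Section IsotopeIsometries.
Variables (R : realType) (W : vectType R) (B : {symmetric W}).
Variable op : {bilinear W -> W -> W}.
Hypothesis Bneg : forall x, x != 0 -> B x x < 0.
Hypothesis dimW : \dim {:W} = 7%N.
Hypothesis alt : alternating (fun x y z => B (op x y) z).
Hypothesis opK : forall x y, op x (op x y) = B x x *: y - B x y *: x.

(* h := s g s'^-1 stabilizes the 3-form, hence is orthogonal, and s g = h s'
   are two polar decompositions of the same map. *)
Lemma isotope_isometry (s s' g : 'End(W)) :
  posdef_symmetric B s -> posdef_symmetric B s' ->
  (forall x y, B (g x) (g y) = B x y) ->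
  (forall x y, g (isotope B op s' x y) = isotope B op s (g x) (g y)) ->
  (forall x, g (s' x) = s (g x)) /\ forall x y, g (op x y) = op (g x) (g y).
Proof.
move=> [bs ss ps] [bs' ss' ps'] gB gM.
have gK := lker0_lfunVK (isometry_lker0 Bneg gB).
have s'K := lker0_lfunVK (bijective_lker0 bs').
have [h hs'] : exists h : 'End(W), forall x, h (s' x) = s (g x).
  exists (s \o g \o s'^-1)%VF => x.
  by rewrite !comp_lfunE lker0_lfunK // bijective_lker0.
have hT x y z : B (op (h x) (h y)) (h z) = B (op x y) z.
  rewrite -[x]s'K -[y]s'K -[z]s'K !hs'.
  by rewrite -!(form_isotope op Bneg) -gM gB.
have hB := stabilizer_isometry Bneg dimW alt opK hT.
have kh := isometry_lker0 Bneg hB.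
have hVK := lker0_lfunVK kh; have hK := lker0_lfunK kh.
(* The operator [k = h s' h^-1] is positive because [h] is an isometry, and [s g = k h]. Thus [s]
   and [k] are both positive square roots of the product of [s g] with its adjoint. *)
have [k kE] : exists k : 'End(W), forall x, k (h x) = h (s' x).
  by exists (h \o s' \o h^-1)%VF => x; rewrite !comp_lfunE hK.
have sk : s = k.
  apply: (positive_square_root_unique Bneg ss ps).
  - by move=> x y; rewrite -[x]hVK -[y]hVK !kE !hB.
  - move=> x; rewrite -[x]hVK; move: (_ x) => {}x x0; rewrite kE hB; apply: ps'.
    by apply: contra_neq x0 => ->; rewrite linear0.
  - move=> x; rewrite -[x]hVK; move: (_ x) => {}x; rewrite !kE.
    (* This is the adjoint of [h s' = s g], as [g] and [h] are isometries. *)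
    have <- : (g^-1)%VF (s (h x)) = s' x.
      by apply: (form_separates Bneg) => z; rewrite -gB gK ss -hs' hB ss'.
    by rewrite hs' gK.
have gh x : g x = h x by apply: (bij_inj bs); rewrite -hs' sk kE.
split=> [x|x y]; first by rewrite gh hs'.
by rewrite !gh (stabilizer_cross Bneg dimW alt opK hT).
Qed.

End IsotopeIsometries.

Section Classification.
Variable R : realType.
Local Notation W := (ImO R).
Local Notation form := (@octform R).
Local Notation cross := (@wedge R).
Let neg := @octform_def R.
Let alt := @oct_alternating R.

Lemma isotope_division (s : 'End(W)) : bijective s ->
  [/\ noncommutative_Jordan (octonion_isotope s), linear_division (octonion_isotope s)
    & \dim {:(R^o * W)%type} = 8%N].
Proof.
move=> bs; have alts := isotope_alternating neg alt s; split.
- exact: quad_noncommutative_Jordan.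
- apply: quad_linear_division => //.
  exact: (isotope_nondegenerate (op := cross) neg (@oct_nondegenerate R) bs).
- by rewrite quad_dim ImO_dim.
Qed.

Lemma positive_isotopes_isomorphic (s s' : 'End(W)) :
  posdef_symmetric form s -> posdef_symmetric form s' ->
  isomorphic (octonion_isotope s') (octonion_isotope s) ->
  exists f, G2 f /\ tilde s' = (f^-1 \o tilde s \o f)%VF.
Proof.
move=> ps ps' [F isoF].
have [g [_ gB gM]] := quad_isomorphism neg neg (isotope_alternating neg alt s')
  (isotope_alternating neg alt s) isoF.
have [gs gc] := isotope_isometry neg (ImO_dim R) alt (@oct_cross_cross R) ps ps' gB gM.
have [|f [isof fE]] := quad_isomorphic (op := cross) (op' := cross) _ gB gc.
  exact: lfun_bijective (isometry_lker0 neg gB) _.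
exists f; split; first exact: isof.
have kf := bijective_lker0 isof.1.
apply/lfunP=> -[a x]; apply: (lker0P kf).
by rewrite !comp_lfunE lker0_lfunVK // fE !tildeE fE /= gs.
Qed.

Lemma positive_isotopes_conjugate (s s' : 'End(W)) f :
  posdef_symmetric form s -> posdef_symmetric form s' ->
  G2 f -> tilde s' = (f^-1 \o tilde s \o f)%VF ->
  isomorphic (octonion_isotope s') (octonion_isotope s).
Proof.
move=> [bs ss ps] [bs' ss' ps'] isof e.
have [g [fE gB gM]] := quad_isomorphism neg neg alt alt isof.
have gs x : g (s' x) = s (g x).
  have := congr1 (fun t : 'End(_) => f (t (0, x))) e; rewrite /= !comp_lfunE.
  rewrite lker0_lfunVK ?(bijective_lker0 isof.1) // !tildeE !fE /=.
  by case.
have [||F [isoF _]] := quad_isomorphic (B := form) (B' := form)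
    (op := isotope form cross s') (op' := isotope form cross s) _ gB.
- exact: lfun_bijective (isometry_lker0 neg gB) _.
- exact: (isotope_conjugate (op := cross) neg ss ss' gs gM).
by exists F.
Qed.

End Classification.

Theorem mainTheorem9 (R : realType) :
  (forall (A : vectType R) (mul : {bilinear A -> A -> A}),
     noncommutative_Jordan mul -> linear_division mul -> \dim {:A} = 8%N ->
     exists phi : 'End(ImO R),
       bijective phi /\ isomorphic mul (octonion_isotope phi)) /\
  (forall (A : vectType R) (mul : {bilinear A -> A -> A}),
     [/\ noncommutative_Jordan mul, linear_division mul & \dim {:A} = 8%N] <->
     exists s : 'End(ImO R),
       posdef_symmetric (@octform R) s /\
       isomorphic mul (octonion_isotope s)) /\
  (forall s s' : 'End(ImO R),
     posdef_symmetric (@octform R) s -> posdef_symmetric (@octform R) s' ->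
     (isomorphic (octonion_isotope s') (octonion_isotope s) <->
      exists f : 'End((R^o * ImO R)%type),
        G2 f /\ tilde s' = (f^-1 \o tilde s \o f)%VF)).
Proof.
have isotope_of (A : vectType R) (mul : {bilinear A -> A -> A}) :
    noncommutative_Jordan mul -> linear_division mul -> \dim {:A} = 8%N ->
    exists phi : 'End(ImO R), bijective phi /\ isomorphic mul (octonion_isotope phi).
  move=> ncj lda dimA; have [one [one0 oneP]] := division_unital ncj lda.
  exact: (division_isotope ncj lda dimA one0 oneP).
split=> //; split=> [A mul|s s' ps ps'].
  split=> [[ncj lda dimA]|[s [[bs _ _] iso]]].
    have [phi [bphi iso]] := isotope_of A mul ncj lda dimA.
    have [s [u [ps bu uB uM]]] := polar_isotope (@wedge R) (@octform_def R) bphi.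
    exists s; split; first exact: ps.
    apply: (isomorphic_trans iso).
    have [F [isoF _]] := quad_isomorphic (op := isotope (@octform R) (@wedge R) phi)
      (op' := isotope (@octform R) (@wedge R) s) bu uB uM.
    by exists F.
  have [ncj lda dim8] := isotope_division bs.
  by have := isomorphic_transport iso ncj lda; rewrite dim8.
split; first exact: (positive_isotopes_isomorphic ps ps').
by case=> f [Gf e]; exact: (positive_isotopes_conjugate ps ps' Gf e).
Qed.
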